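(* Let $a_k=\exp(\alpha k)$ and $\sigma_k=\exp(\beta k)$, $k\in\mathbb N$, with $\alpha>0,\beta>0$; let $\kappa=(\alpha,\beta,q)$ and let $\Sigma$ be a compact subset of $(0,\infty)^2\times(0,2]$. Put $\phi(\kappa)=\frac{1}{2(\alpha+\beta)}$, $\phi(\Sigma)=\{\phi(\kappa):\kappa\in\Sigma\}$. All limits are as $\varepsilon\to0$. (a) (Lower bounds.) Suppose $\phi(\Sigma)$ contains an interval $[a,b]$, $0<a<b<\infty$. Then there exists a constant $d>0$ such that if $$\limsup_{\varepsilon\to0}\ \sup_{\kappa\in\Sigma}\frac{u_\varepsilon(\kappa)}{\log\log(\varepsilon^{-1})}\le d,$$ then $\gamma_\varepsilon(\Theta_\varepsilon(\Sigma))\to1$. (b) (Upper bounds.) Let $C>2$, let $L=L_\varepsilon$ be integer-valued with $L_\varepsilon\to\infty$, $L_\varepsilon=o(\log\log(\varepsilon^{-1}))$, and let $$H_k=\begin{cases}\sqrt{2\log L},&k<L,\\ \sqrt{C\log k},&k\ge L,\end{cases}\qquad \psi_\varepsilon=\mathbf 1\{\exists\,k\in\mathbb N:\ |y_k|>\varepsilon H_k\}.$$ Then $\alpha_\varepsilon(\psi_\varepsilon)=o(1)$, and there exists a constant $D=D(\Sigma)>0$ such that if $$\liminf_{\varepsilon\to0}\ \inf_{\kappa\in\Sigma}\frac{u_\varepsilon(\kappa)}{\log\log(\varepsilon^{-1})}>D,$$ then $\beta_\varepsilon(\Theta_\varepsilon(\Sigma),\psi_\varepsilon)=o(1)$. (c)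 (Adaptive separation rates.) For $\Sigma$ as in (a), the adaptive separation rates $r^{\mathrm{ad}}_\varepsilon(\kappa)$, $\kappa\in\Sigma$ (corresponding to $u^{\mathrm{ad}}_\varepsilon=\log\log(\varepsilon^{-1})$), are given by $$r^{\mathrm{ad}}_\varepsilon(\kappa)=\Big(\varepsilon\sqrt{\log\log(\varepsilon^{-1})}\Big)^{\alpha/(\alpha+\beta)}.$$
   Context: Model: one observes $y=\{y_k\}_{k\in\mathbb N}$, $y_k=\eta_k+\varepsilon\xi_k$, with $\xi_k$ i.i.d. $N(0,1)$, $\varepsilon>0$ small, $\eta\in\ell^2$ unknown; $E_{\varepsilon,\eta}$ is the corresponding expectation. A test $\psi$ is a measurable function of $y$ with values in $[0,1]$; $\alpha_\varepsilon(\psi)=E_{\varepsilon,0}\psi$, $\beta_\varepsilon(\Theta,\psi)=\sup_{\eta\in\Theta}E_{\varepsilon,\eta}(1-\psi)$, $\gamma_\varepsilon(\Theta)=\inf_\psi\big(\alpha_\varepsilon(\psi)+\beta_\varepsilon(\Theta,\psi)\big)$. Adaptive setting: a family of radii $r_\varepsilon(\kappa)>0$, $\kappa\in\Sigma$, with $r_\varepsilon(\kappa)\to0$ as $\varepsilon\to0$, is given. For $\kappa\in\Sigma$ and $r>0$, $$\Theta_\varepsilon(\kappa,r)=\Big\{\eta\in\ell^2:\sum_k|a_k\sigma_k\eta_k|^q\le1,\ \sum_k\sigma_k^2\eta_k^2\ge r^2\Big\}$$ with $a_k=a_k(\kappa)$, $\sigma_k=\sigma_k(\kappa)$, $q=q(\kappa)$,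 and $\Theta_\varepsilon(\Sigma)=\bigcup_{\kappa\in\Sigma}\Theta_\varepsilon(\kappa,r_\varepsilon(\kappa))$. One tests $H_0:\eta=0$ against $H_1:\eta\in\Theta_\varepsilon(\Sigma)$. Define $u_\varepsilon(\kappa,r)$ by $u_\varepsilon^2(\kappa,r)=\frac{1}{2\varepsilon^4}\inf_{\eta\in\Theta_\varepsilon(\kappa,r)}\sum_k\eta_k^4$, and $u_\varepsilon(\kappa)=u_\varepsilon(\kappa,r_\varepsilon(\kappa))$. A family $u^{\mathrm{ad}}_\varepsilon\to\infty$ characterizes adaptive distinguishability if there are constants $0<d\le D<\infty$ (depending on $\Sigma$) such that $\gamma_\varepsilon(\Theta_\varepsilon(\Sigma))\to1$ when $\limsup_{\varepsilon\to0}\sup_{\kappa\in\Sigma}u_\varepsilon(\kappa)/u^{\mathrm{ad}}_\varepsilon<d$, and $\gamma_\varepsilon(\Theta_\varepsilon(\Sigma))\to0$ when $\liminf_{\varepsilon\to0}\inf_{\kappa\in\Sigma}u_\varepsilon(\kappa)/u^{\mathrm{ad}}_\varepsilon>D$. A family $r^{\mathrm{ad}}_\varepsilon(\kappa)$, $\kappa\in\Sigma$, with $u^{\mathrm{ad}}_\varepsilon\asymp u_\varepsilon(\kappa,r^{\mathrm{ad}}_\varepsilon(\kappa))$ is called the family of adaptive separation rates. ($\asymp$: ratio bounded above and away from $0$ for small $\varepsilon$.) *)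

(* Defs.v *)
From HB Require Import structures.
From mathcomp Require Import all_boot all_order all_algebra finmap.
From mathcomp Require Import all_classical all_reals all_analysis.

Set Implicit Arguments.
Unset Strict Implicit.
Unset Printing Implicit Defensive.

Import Order.TTheory GRing.Theory Num.Theory.
Import numFieldNormedType.Exports.

Local Open Scope classical_set_scope.
Local Open Scope ring_scope.

(* Sequences indexed by k = 1, 2, ... are functions on nat whose value at n is
   the entry of index k = n.+1. *)

Definition mutually_independent (R : realType) (d : measure_display)
    (Omega : measurableType d) (P : probability Omega R)
    (X : nat -> {RV P >-> R}) : Prop :=
  forall (J : {fset nat}) (B : nat -> set R),
    (forall n, measurable (B n)) ->
    P (\bigcap_(n in [set` J]) (X n @^-1` B n)) =
    (\prod_(n <- J) P (X n @^-1` B n))%E.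

Definition iid_standard_normal (R : realType) (d : measure_display)
    (Omega : measurableType d) (P : probability Omega R)
    (xi : nat -> {RV P >-> R}) : Prop :=
  mutually_independent xi /\
  forall n (B : set R), measurable B ->
    distribution P (xi n) B = normal_prob 0 1 B.

Definition observation (R : realType) (d : measure_display)
    (Omega : measurableType d) (P : probability Omega R)
    (xi : nat -> {RV P >-> R}) (eps : R) (eta : nat -> R) (w : Omega) :
    nat -> R :=
  fun n => eta n + eps * xi n w.

(* E_{eps,eta} f(y). It is only applied to functions with values in [0, 1],
   whose expectation is finite, so that [fine] is harmless. *)
Definition mean (R : realType) (d : measure_display)
    (Omega : measurableType d) (P : probability Omega R)
    (xi : nat -> {RV P >-> R}) (eps : R) (eta : nat -> R)
    (f : (nat -> R) -> R) : R :=
  fine ('E_P[fun w => f (observation xi eps eta w)])%E.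

(* Generators of the product sigma-algebra on R^N. *)
Definition cylinders (R : realType) : set (set (nat -> R)) :=
  \bigcup_n preimage_set_system setT (fun y : nat -> R => y n) measurable.

Definition is_test (R : realType) (psi : (nat -> R) -> R) : Prop :=
  measurable_fun setT (psi : g_sigma_algebraType (@cylinders R) -> R) /\
  forall y, 0 <= psi y <= 1.

Definition type1_error (R : realType) (d : measure_display)
    (Omega : measurableType d) (P : probability Omega R)
    (xi : nat -> {RV P >-> R}) (eps : R) (psi : (nat -> R) -> R) : R :=
  mean xi eps (fun=> 0) psi.

(* The real-valued [sup] of the empty set is 0, as it should be for a supremum
   of probabilities over an empty alternative. *)
Definition type2_error (R : realType) (d : measure_display)
    (Omega : measurableType d) (P : probability Omega R)
    (xi : nat -> {RV P >-> R}) (eps : R) (Theta : set (nat -> R))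
    (psi : (nat -> R) -> R) : R :=
  sup [set mean xi eps eta (fun y => 1 - psi y) | eta in Theta].

Definition minimax_error (R : realType) (d : measure_display)
    (Omega : measurableType d) (P : probability Omega R)
    (xi : nat -> {RV P >-> R}) (eps : R) (Theta : set (nat -> R)) : R :=
  inf [set type1_error xi eps psi + type2_error xi eps Theta psi |
       psi in @is_test R].

Record ellipsoids (R : realType) (K : Type) := Ellipsoids {
  semiaxis : K -> nat -> R;   (* a_k(kappa) *)
  illposed : K -> nat -> R;   (* sigma_k(kappa) *)
  exponent : K -> R           (* q(kappa) *)
}.

Definition Theta (R : realType) (K : Type) (F : ellipsoids R K) (kappa : K)
    (r : R) : set (nat -> R) :=
  [set eta | [/\ (\sum_(0 <= n <oo) (eta n ^+ 2)%:E < +oo)%E,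
     (\sum_(0 <= n <oo)
        (`|semiaxis F kappa n * illposed F kappa n * eta n|
           `^ exponent F kappa)%:E <= 1)%E &
     ((r ^+ 2)%:E <=
      \sum_(0 <= n <oo) (illposed F kappa n ^+ 2 * eta n ^+ 2)%:E)%E]].

Definition Theta_adaptive (R : realType) (K : Type) (F : ellipsoids R K)
    (Sigma : set K) (r : K -> R) : set (nat -> R) :=
  \bigcup_(kappa in Sigma) Theta F kappa (r kappa).

(* Extended-real valued: equal to +oo when Theta F kappa r is empty. *)
Definition u_eps (R : realType) (K : Type) (F : ellipsoids R K) (eps : R)
    (kappa : K) (r : R) : \bar R :=
  sqrte (((2 * eps ^+ 4)^-1)%:E *
    ereal_inf [set (\sum_(0 <= n <oo) (eta n ^+ 4)%:E)%E |
               eta in Theta F kappa r])%E.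

Definition radii (R : realType) (K : Type) (Sigma : set K)
    (r : R -> K -> R) : Prop :=
  forall kappa, Sigma kappa ->
    (forall eps, 0 < eps -> 0 < r eps kappa) /\
    r eps kappa @[eps --> 0^'+] --> (0 : R).

Definition limsup_sup_ratio (R : realType) (K : Type) (F : ellipsoids R K)
    (Sigma : set K) (r : R -> K -> R) (uad : R -> R) : \bar R :=
  limf_esup (fun eps : R =>
    ereal_sup [set (u_eps F eps kappa (r eps kappa) * ((uad eps)^-1)%:E)%E |
               kappa in Sigma]) 0^'+.

Definition liminf_inf_ratio (R : realType) (K : Type) (F : ellipsoids R K)
    (Sigma : set K) (r : R -> K -> R) (uad : R -> R) : \bar R :=
  limf_einf (fun eps : R =>
    ereal_inf [set (u_eps F eps kappa (r eps kappa) * ((uad eps)^-1)%:E)%E |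
               kappa in Sigma]) 0^'+.

(* The constants depend on Sigma only, not on the family of radii. *)
Definition characterizes_adaptive_distinguishability (R : realType)
    (d : measure_display) (Omega : measurableType d) (P : probability Omega R)
    (xi : nat -> {RV P >-> R}) (K : Type) (F : ellipsoids R K)
    (Sigma : set K) (uad : R -> R) : Prop :=
  uad eps @[eps --> 0^'+] --> +oo /\
  exists lo hi : R, [/\ 0 < lo, lo <= hi &
    forall r : R -> K -> R, radii Sigma r ->
      ((limsup_sup_ratio F Sigma r uad < lo%:E)%E ->
       minimax_error xi eps (Theta_adaptive F Sigma (r eps))
         @[eps --> 0^'+] --> (1 : R)) /\
      ((hi%:E < liminf_inf_ratio F Sigma r uad)%E ->
       minimax_error xi eps (Theta_adaptive F Sigma (r eps))
         @[eps --> 0^'+] --> (0 : R))].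

(* The relation uad eps ~ u_eps(kappa, rad eps kappa) is uniform in
   kappa \in Sigma. *)
Definition adaptive_separation_rates (R : realType)
    (d : measure_display) (Omega : measurableType d) (P : probability Omega R)
    (xi : nat -> {RV P >-> R}) (K : Type) (F : ellipsoids R K)
    (Sigma : set K) (uad : R -> R) (rad : R -> K -> R) : Prop :=
  characterizes_adaptive_distinguishability xi F Sigma uad /\
  exists c C : R, [/\ 0 < c, 0 < C &
    \forall eps \near 0^'+, forall kappa, Sigma kappa ->
      ((c * uad eps)%:E <= u_eps F eps kappa (rad eps kappa))%E /\
      (u_eps F eps kappa (rad eps kappa) <= (C * uad eps)%:E)%E].

Definition alpha_of (R : realType) (kappa : R * R * R) : R := kappa.1.1.
Definition beta_of (R : realType) (kappa : R * R * R) : R := kappa.1.2.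
Definition q_of (R : realType) (kappa : R * R * R) : R := kappa.2.

Definition exp_ellipsoids (R : realType) : ellipsoids R (R * R * R) :=
  {| semiaxis := fun kappa n => expR (alpha_of kappa * n.+1%:R);
     illposed := fun kappa n => expR (beta_of kappa * n.+1%:R);
     exponent := @q_of R |}.

Definition phi (R : realType) (kappa : R * R * R) : R :=
  (2 * (alpha_of kappa + beta_of kappa))^-1.

Definition loglog (R : realType) (eps : R) : R := ln (ln eps^-1).

Definition phi_contains_interval (R : realType) (Sigma : set (R * R * R)) :
    Prop :=
  exists a b : R, [/\ 0 < a, a < b &
    [set t | a <= t <= b] `<=` [set phi kappa | kappa in Sigma]].

Definition threshold (R : realType) (C : R) (L : int) (k : nat) : R :=
  if (k%:Z < L) then Num.sqrt (2 * ln L%:~R) else Num.sqrt (C * ln k%:R).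

Definition threshold_test (R : realType) (C : R) (L : int) (eps : R)
    (y : nat -> R) : R :=
  \1_[set z : nat -> R | exists n, eps * threshold C L n.+1 < `|z n|] y.

Definition admissible_L (R : realType) (L : R -> int) : Prop :=
  ((L eps)%:~R : R) @[eps --> 0^'+] --> +oo /\
  ((L eps)%:~R / loglog eps) @[eps --> 0^'+] --> (0 : R).

Definition exp_rate (R : realType) (eps : R) (kappa : R * R * R) : R :=
  (eps * Num.sqrt (loglog eps))
    `^ (alpha_of kappa / (alpha_of kappa + beta_of kappa)).

(* Main.v *)
Require Import Defs.
From HB Require Import structures.
From mathcomp Require Import all_boot all_order all_algebra finmap.
From mathcomp Require Import all_classical all_reals all_analysis.
From mathcomp Require Import measurable_realfun ring lra.

(** Why an interval of values of phi: a spike of height z = exp(-l) lies in the ellipsoid of kappa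
    only at coordinates k <= l/(alpha+beta), and its weighted norm exp(beta k) z reaches a radius of
    critical order only for k within O(1) of that bound. A fixed kappa thus offers O(1) positions;
    letting phi(kappa) run through an interval moves this window across a stretch of coordinates of
    length proportional to l.

    Why the factor 1/2 in the height: for spikes of height eps * sqrt(c loglog(1/eps)) the
    chi-square distance is of order (log(1/eps))^(c-1), so every c < 1 would do.

    Only one coordinate is shifted at a time. The likelihood ratio therefore involves a single noise
    variable, and the change of measure for sequences reduces, through finite rectangles, to a shift
    of the real normal law.

    At level sqrt(2 log L) the exponential part of the Gaussian tail only balances the number L of
    coordinates; it is the factor 1/t in the tail bound that makes the first-kind error vanish. *)

(** The largest coordinate of an [eta] in Theta(kappa, r) is at least of order
    r^((alpha+beta)/alpha), since |eta_k| <= exp(-(alpha+beta)k) and the weighted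
    sum of squares then peaks where exp(-(alpha+beta)k) crosses the largest
    coordinate; a single spike shows that this order is sharp. Hence u_eps is of
    the order of r^(2(alpha+beta)/alpha)/eps^2, uniformly over a compact Sigma,
    and testing reduces to detecting one coordinate of size
    eps * sqrt(loglog(1/eps)) among the first O(log(1/eps)) ones.

    Upper bound: for such a coordinate the threshold H_k is beaten with room to
    spare, while the null exceedances of the thresholds are summable.

    Lower bound: if phi(Sigma) contains an interval, then about log(1/eps)
    consecutive coordinates can carry a spike of height
    eps * sqrt(loglog(1/eps)/2); the chi-square distance between the uniform
    mixture over these spikes and the null is at most
    (log(1/eps))^(1/2) / log(1/eps), up to a constant. *)

Set Implicit Arguments.
Unset Strict Implicit.
Unset Printing Implicit Defensive.

Import Order.TTheory GRing.Theory Num.Theory.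
Import numFieldNormedType.Exports.

Local Open Scope classical_set_scope.
Local Open Scope ring_scope.

(** * Densities *)

Section density.
Local Open Scope ereal_scope.
Import HBNNSimple.

(** On level sets of simple functions this is [nuE]; monotone convergence along [nnsfun_approx] does
    the rest. It serves three pairs: the normal law against Lebesgue measure, [P] restricted to an
    event (density an indicator), and an exponentially tilted [P]. *)
Lemma integral_density d (T : measurableType d) (R : realType)
    (mu nu : {measure set T -> \bar R}) (f : T -> R) (g : T -> \bar R) :
  measurable_fun setT f -> (forall x, (0 <= f x)%R) ->
  (forall A, measurable A -> nu A = \int[mu]_(x in A) (f x)%:E) ->
  measurable_fun setT g -> (forall x, 0 <= g x) ->
  \int[nu]_x g x = \int[mu]_x (g x * (f x)%:E).
Proof.
move=> mf f0 nuE mg g0.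
have mfE : measurable_fun setT (EFin \o f) by exact/measurable_EFinP.
pose g_ := nnsfun_approx measurableT mg.
have gcvg x : (g_ n x)%:E @[n --> \oo] --> g x by exact: cvg_nnsfun_approx.
transitivity (limn (fun n => \int[nu]_x (g_ n x)%:E)).
  rewrite -monotone_convergence//.
  - by apply: eq_integral => x _; apply/esym/cvg_lim.
  - by move=> n; exact/measurable_EFinP/measurable_funP.
  - by move=> n x _; rewrite lee_fin.
  - by move=> x _ m n mn; rewrite lee_fin; exact/lefP/nd_nnsfun_approx.
transitivity (limn (fun n => \int[mu]_x ((g_ n x)%:E * (f x)%:E))); last first.
  rewrite -monotone_convergence//.
  - by apply: eq_integral => x _; apply/cvg_lim => //; apply: cvgeZr.
  - move=> n; apply: emeasurable_funM => //.
    exact/measurable_EFinP/measurable_funP.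
  - by move=> n x _; rewrite mule_ge0// lee_fin.
  - move=> x _ m n mn; rewrite lee_wpmul2r ?lee_fin//.
    exact/lefP/nd_nnsfun_approx.
apply/congr_lim/funext => n.
transitivity (\sum_(k \in range (g_ n))
    \int[nu]_x (k * \1_(g_ n @^-1` [set k]) x)%:E).
  rewrite -ge0_integral_fsum//.
  - by apply: eq_integral => x _; rewrite fsumEFin// -fimfunE.
  - by move=> r; exact/measurable_EFinP/measurable_funM.
  - by move=> r x _; rewrite nnfun_muleindic_ge0.
transitivity (\sum_(k \in range (g_ n))
    \int[mu]_x ((k * \1_(g_ n @^-1` [set k]) x)%:E * (f x)%:E)); last first.
  rewrite -ge0_integral_fsum//.
  - apply: eq_integral => x _; rewrite -ge0_mule_fsuml.
      by rewrite fsumEFin// -fimfunE.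
    by move=> r; rewrite nnfun_muleindic_ge0.
  - move=> r; apply: emeasurable_funM => //.
    exact/measurable_EFinP/measurable_funM.
  - by move=> r x _; rewrite mule_ge0// ?nnfun_muleindic_ge0// lee_fin.
apply: eq_fsbigr => r; rewrite inE => -[x _ grx].
have r0 : (0 <= r)%R by rewrite -grx.
under eq_integral do rewrite EFinM.
under [in RHS]eq_integral do rewrite EFinM -muleA.
have mr : measurable (g_ n @^-1` [set r]) by [].
have mI : measurable_fun setT (fun y => (\1_(g_ n @^-1` [set r]) y)%:E : \bar R).
  exact/measurable_EFinP.
rewrite (ge0_integralZl _ measurableT mI)// ge0_integralZl//; last 2 first.
- exact: emeasurable_funM.
- by move=> y _; rewrite mule_ge0 ?lee_fin.
congr (_ * _); rewrite integral_indic// setIT nuE// integral_mkcond.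
apply: eq_integral => y _; rewrite patchE indicE.
by case: ifP => _; rewrite ?mul1e ?mul0e.
Qed.

End density.

(** The proofs [mf] and [f0] are arguments so that the measure instance below can be attached to the
    term itself. *)
Definition density d (T : measurableType d) (R : realType)
    (mu : {measure set T -> \bar R}) (f : T -> R)
    (mf : measurable_fun setT f) (f0 : forall x, 0 <= f x) (A : set T) :
    \bar R :=
  (\int[mu]_(x in A) (f x)%:E)%E.

Section density_measure.
Local Open Scope ereal_scope.
Context d (T : measurableType d) (R : realType).
Variables (mu : {measure set T -> \bar R}) (f : T -> R).
Hypotheses (mf : measurable_fun setT f) (f0 : forall x, (0 <= f x)%R).

Let nu := density mu mf f0.

Let nu0 : nu set0 = 0.
Proof. by rewrite /nu /density integral_set0. Qed.

Let nu_ge0 A : 0 <= nu A.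
Proof. by apply: integral_ge0 => x _; rewrite lee_fin. Qed.

Let nu_sigma_additive : semi_sigma_additive nu.
Proof.
move=> F mF tF mU; rewrite /nu /density ge0_integral_bigcup//.
- apply: is_cvg_ereal_nneg_natsum_cond => n _ _.
  by apply: integral_ge0 => x _; rewrite lee_fin.
- exact/measurable_EFinP/measurable_funTS.
- by move=> x _; rewrite lee_fin.
Qed.

HB.instance Definition _ := isMeasure.Build _ _ _ nu nu0 nu_ge0
  nu_sigma_additive.

End density_measure.

(** * Gaussian shifts and tails *)

Lemma measurable_addr (R : realType) (c : R) :
  measurable_fun setT (fun x : R => x + c : measurableTypeR R).
Proof. exact: measurable_funD. Qed.

Lemma lebesgue_measureD (R : realType) (c : R) (A : set R) : measurable A ->
  pushforward (@lebesgue_measure R) (fun x => x + c : measurableTypeR R) A =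
  lebesgue_measure A.
Proof.
move=> mA.
apply/esym/lebesgue_measure_unique => //= [|mF _ [[a b]] _ <-].
  exact: measurable_addr.
rewrite /pushforward /= (_ : _ @^-1` _ = `]a - c, b - c]%classic); last first.
  by apply/seteqP; split => x /=; rewrite !in_itv/= ltrBlDr lerBrDr.
rewrite !lebesgue_measure_itv/= !lte_fin ltrD2r.
by case: ifP => // _; rewrite -!EFinB; congr EFin; rewrite opprB addrA subrK.
Qed.

Lemma ge0_integral_shift (R : realType) (c : R) (f : R -> \bar R) :
  measurable_fun setT f -> (forall x, 0 <= f x)%E ->
  (\int[lebesgue_measure]_x f (x + c)%R = \int[lebesgue_measure]_x f x)%E.
Proof.
move=> mf f0.
have := @ge0_integral_pushforward _ _ (measurableTypeR R) (measurableTypeR R) R _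
  (measurable_addr c) (@lebesgue_measure R) setT f measurableT mf.
rewrite preimage_setT => <-; last by [].
apply: eq_measure_integral => [|? A mA _]; first exact: measurable_addr.
exact: lebesgue_measureD.
Qed.

Lemma normal_pdf_std (R : realType) (x : R) :
  normal_pdf 0 1 x = normal_peak 1 * expR (- (x ^+ 2 / 2)).
Proof.
rewrite normal_pdfE ?oner_neq0//= /normal_fun subr0 expr1n.
by rewrite mulNr.
Qed.

(** The left side is the N(b, 1) mass of [B]. After translating the right-hand integral by [b],
    completing the square turns the tilt times the density at [x + b] into the density at [x]. *)
Lemma normal_probD (R : realType) (b : R) (B : set R) : measurable B ->
  normal_prob 0 1 [set x | B (x + b)] =
  (\int[normal_prob 0 1]_(x in B) (expR (b * x - b ^+ 2 / 2))%:E)%E.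
Proof.
move=> mB.
have mpdf (a : R) := @measurable_normal_pdf R a 1.
have mexp : measurable_fun setT (fun x : R => expR (b * x - b ^+ 2 / 2)).
  by apply: measurableT_comp => //; apply: measurable_funB.
rewrite [RHS]integral_mkcond.
rewrite (@integral_density _ _ _ (@lebesgue_measure R) _ (normal_pdf 0 1))//; first last.
- by move=> x; rewrite patchE; case: ifP => // _; rewrite lee_fin expR_ge0.
- apply/(measurable_restrictT _ _).1 => //.
  exact/measurable_funTS/measurable_EFinP.
- by move=> x; exact: normal_pdf_ge0.
- exact: mpdf.
rewrite /normal_prob [LHS]integral_mkcond.
rewrite -(@ge0_integral_shift _ b (fun x => _ * _)%E); last 2 first.
- apply: emeasurable_funM; last exact/measurable_EFinP.
  apply/(measurable_restrictT _ _).1 => //.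
  exact/measurable_funTS/measurable_EFinP.
- move=> x; rewrite mule_ge0 ?lee_fin ?normal_pdf_ge0//.
  by rewrite patchE; case: ifP => // _; rewrite lee_fin expR_ge0.
apply: eq_integral => x _.
rewrite !patchE.
rewrite (_ : (x \in [set x | B (x + b)]) = (x + b \in B)); last first.
  by apply/idP/idP; rewrite !inE.
case: ifP => _; last by rewrite mul0e.
rewrite -EFinM; congr EFin; rewrite !normal_pdf_std mulrCA; congr (_ * _).
rewrite -expRD; congr expR.
by field.
Qed.

Lemma normal_peak1_le1 (R : realType) : normal_peak (1 : R) <= 1.
Proof.
have pi2 := @pi_ge2 R.
rewrite /normal_peak expr1n mul1r invf_le1 ?sqrtr_gt0; last by lra.
by rewrite -[leLHS]sqrtr1 ler_wsqrtr//; lra.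
Qed.

Lemma cvg_expR_sqrN (R : realType) :
  expR (- (x ^+ 2 / 2)) @[x --> +oo] --> (0 : R).
Proof.
apply: (cvg_comp (fun x : R => x ^+ 2 / 2) (fun x => expR (- x)));
  last exact: cvgr_expR.
apply: gt0_cvgMly; last exact: cvgr_expr2.
by rewrite invr_gt0.
Qed.

(** On [[t, +oo[] the factor [x / t] is at least 1, and inserting it gives the integrand an explicit
    primitive; the normalizing constant is bounded by 1. *)
Lemma normal_prob_upper_tail (R : realType) (t : R) : 0 < t ->
  (normal_prob 0%R 1%R (`[t, +oo[%classic : set R) <=
   (expR (- (t ^+ 2 / 2)) / t)%:E)%E.
Proof.
move=> t0.
pose F (x : R) := - (expR (- (x ^+ 2 / 2)) / t).
pose f (x : R) := x / t * expR (- (x ^+ 2 / 2)).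
have dF (x : R) : is_derive x 1 F (f x).
  rewrite /F /f; apply: is_derive_eq.
  by rewrite /GRing.scale/=; field; rewrite gt_eqF.
have mf : measurable_fun setT f.
  apply: measurable_funM; first exact: measurable_funM.
  apply: measurableT_comp => //; apply: measurableT_comp => //.
  exact: measurable_funM.
have df (x : R) : derivable f x 1 by rewrite /f.
have cf : continuous f.
  by move=> x; exact/differentiable_continuous/derivable1_diffP/df.
have cF : continuous F.
  by move=> x; apply/differentiable_continuous/derivable1_diffP; have [] := dF x.
have f0 x : t <= x -> 0 <= f x.
  by move=> tx; rewrite mulr_ge0 ?expR_ge0// divr_ge0 ?(ltW t0)// (le_trans _ tx)// ltW.
rewrite /normal_prob.
apply: (@le_trans _ _ (\int[lebesgue_measure]_(x in `[t, +oo[) (f x)%:E)%E).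
  apply: ge0_le_integral => //.
  - by move=> x _; rewrite lee_fin normal_pdf_ge0.
  - apply/measurable_EFinP/measurable_funTS; exact: measurable_normal_pdf.
  - exact/measurable_EFinP/measurable_funTS.
  - move=> x /=; rewrite in_itv/= andbT => tx.
    rewrite lee_fin normal_pdf_std ler_wpM2r ?expR_ge0//.
    by rewrite (le_trans (@normal_peak1_le1 R))// ler_pdivlMr// mul1r.
rewrite (@ge0_continuous_FTC2y _ f F t 0)//.
- by rewrite sub0e -EFinN lee_fin opprK.
- exact: continuous_subspaceT.
- rewrite -[X in _ --> X]oppr0 -[X in - X](mul0r t^-1); apply: cvgN; apply: cvgMl.
  exact: cvg_expR_sqrN.
- by apply: cvg_at_right_filter; exact: cF.
- by move=> x _; rewrite derive1E; apply/derive_val.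
Qed.

Lemma normal_prob_tail (R : realType) (t : R) : 0 < t ->
  (normal_prob 0%R 1%R [set x : R | (t <= `|x|)%R] <=
   (2 * (expR (- (t ^+ 2 / 2)) / t))%:E)%E.
Proof.
move=> t0.
have -> : [set x : R | t <= `|x|] = `]-oo, (- t)%R] `|` `[t, +oo[.
  apply/seteqP; split => x /=; rewrite !in_itv/= andbT ler_normr lerNr.
    by move=> /orP[]; [right|left].
  by case=> ->; rewrite ?orbT.
apply: le_trans (measureU2 _ _ _) _ => //.
rewrite mulr2n mulrDl !mul1r EFinD; apply: leeD; last exact: normal_prob_upper_tail.
apply: le_trans (normal_prob_upper_tail t0).
rewrite -[leLHS]/(normal_prob 0 1 _) /normal_prob.
rewrite ge0_integration_by_substitutionNy.
- apply: ge0_le_integral => //.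
  - by move=> x _; rewrite lee_fin normal_pdf_ge0.
  - apply/measurable_EFinP/measurable_funTS; apply: measurableT_comp => //.
    exact: measurable_normal_pdf.
  - apply/measurable_EFinP/measurable_funTS; exact: measurable_normal_pdf.
  - by move=> x _; rewrite lee_fin /= !normal_pdf_std sqrrN.
- by apply: continuous_subspaceT; apply: continuous_normal_pdf.
- by move=> x _; exact: normal_pdf_ge0.
Qed.

(** * Shifting one coordinate of the noise *)

Definition spike (R : realType) (m : nat) (z : R) (n : nat) : R :=
  if n == m then z else 0.

Notation seqspace R := (g_sigma_algebraType (@cylinders R)).

Lemma measurable_coord (R : realType) (n : nat) :
  measurable_fun setT (fun y : seqspace R => y n).
Proof.
move=> _ B mB; apply: sub_sigma_algebra; exists n => //=.
by exists B.
Qed.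

Lemma measurable_to_seqspace d (T : measurableType d) (R : realType)
    (f : T -> seqspace R) :
  (forall n, measurable_fun setT (fun t => f t n)) -> measurable_fun setT f.
Proof.
move=> mf; apply: (@measurability _ _ T (seqspace R) setT f (@cylinders R)) => //.
move=> _ [_ [n _ [B mB <-]] <-].
rewrite !setTI -[X in measurable X]setTI.
exact: mf.
Qed.

(** Rectangles restricting only the coordinates in [J]. Unlike the one-coordinate generators
    [cylinders], they are stable under intersection, so two finite measures agreeing on them agree
    everywhere. *)
Definition finite_cylinders (R : realType) : set (set (nat -> R)) :=
  [set A | exists (J : {fset nat}) (B : nat -> set R),
    [/\ forall n, measurable (B n), forall n, n \notin J -> B n = setT &
        A = [set y | forall n, B n (y n)]]].

Lemma finite_cylindersE (R : realType) :
  @measurable _ (seqspace R) = <<s @finite_cylinders R >>.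
Proof.
apply/seteqP; split.
  apply: smallest_sub; first exact: smallest_sigma_algebra.
  move=> _ [n _ [B mB <-]]; apply: sub_sigma_algebra.
  exists [fset n]%fset, (fun k => if k == n then B else setT); split.
  - by move=> k; case: ifP.
  - by move=> k; rewrite inE => /negbTE ->.
  - rewrite setTI; apply/seteqP; split => [y /= By k|y /= /(_ n)].
      by case: eqVneq => // ->.
    by rewrite eqxx.
apply: smallest_sub; first exact: smallest_sigma_algebra.
move=> _ [J [B [mB BT ->]]].
rewrite (_ : [set _ | _] =
    \bigcap_n ((fun y : seqspace R => y n) @^-1` B n)); last first.
  by apply/seteqP; split => y /= yB n; [move=> _|]; exact: yB.
apply: bigcap_measurable => [|n _]; first by exists 0.
by rewrite -[X in _ X]setTI; exact: measurable_coord.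
Qed.

Lemma finite_cylinders_setI (R : realType) : setI_closed (@finite_cylinders R).
Proof.
move=> _ _ [J1 [B1 [mB1 T1 ->]]] [J2 [B2 [mB2 T2 ->]]].
exists (J1 `|` J2)%fset, (fun n => B1 n `&` B2 n); split.
- by move=> n; exact: measurableI.
- by move=> n; rewrite inE negb_or => /andP[/T1 -> /T2 ->]; rewrite setTI.
- apply/seteqP; split => [y /= [y1 y2] n|y /= y12].
    by split; [exact: y1|exact: y2].
  by split => n; have [] := y12 n.
Qed.

Lemma seqspace_measure_unique (R : realType)
    (m1 m2 : {measure set (seqspace R) -> \bar R}) :
  (m1 setT < +oo)%E ->
  (forall A, finite_cylinders A -> m1 A = m2 A) ->
  forall A, measurable A -> m1 A = m2 A.
Proof.
move=> m1T m12; 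
apply: (@measure_unique _ R (seqspace R) (@finite_cylinders R)
  (fun=> setT)) => //.
- exact: finite_cylindersE.
- exact: finite_cylinders_setI.
- move=> _; exists fset0, (fun=> setT); split => //.
  by apply/seteqP; split.
- by apply: bigcup_const; exists 0.
Qed.

Section shift.
Context (R : realType) (d : measure_display) (Omega : measurableType d)
  (P : probability Omega R) (xi : nat -> {RV P >-> R}).

Lemma measurable_observation (eps : R) (eta : nat -> R) :
  measurable_fun setT (observation xi eps eta : Omega -> seqspace R).
Proof.
apply: measurable_to_seqspace => n; rewrite /observation.
by apply: measurable_funD => //; apply: measurable_funM.
Qed.

Hypothesis iid_xi : iid_standard_normal xi.

(** For indicator integrands this is independence. In general, restrict [P] to the event on the
    coordinates in [J]: by independence its image under [xi m] is the normal law times the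
    probability of that event. *)
Lemma iid_integral (m : nat) (J : {fset nat}) (C : nat -> set R)
    (L : R -> R) :
  m \notin J -> (forall n, measurable (C n)) -> measurable_fun setT L ->
  (forall x, 0 <= L x) ->
  (\int[P]_(w in \bigcap_(n in [set` (m |` J)%fset]) (xi n @^-1` C n))
     (L (xi m w))%:E =
   (\prod_(n <- J) normal_prob 0 1 (C n)) *
     \int[normal_prob 0 1]_(x in C m) (L x)%:E)%E.
Proof.
move=> mJ mC mL L0.
have [ind dist] := iid_xi.
have mX n (B : set R) : measurable B -> measurable (xi n @^-1` B).
  by move=> mB; rewrite -[X in measurable X]setTI; exact: measurable_funP.
pose E0 := \bigcap_(n in [set` J]) (xi n @^-1` C n).
have mE0 : measurable E0.
  by apply: fin_bigcap_measurable => // n _; exact: mX.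
pose c := fine (P E0).
have c0 : (0 <= c)%R by rewrite fine_ge0.
have cE : P E0 = c%:E by rewrite fineK// fin_num_measure.
have PB (B : set R) : measurable B ->
    P (xi m @^-1` B `&` E0) = (c%:E * normal_prob 0 1 B)%E.
  move=> mB.
  pose C' n := if n == m then B else C n.
  have mC' n : measurable (C' n) by rewrite /C'; case: ifP.
  have C'J n : n \in J -> C' n = C n.
    by rewrite /C'; case: eqVneq => // ->; rewrite (negbTE mJ).
  have := ind (m |` J)%fset C' mC'.
  rewrite big_fsetU1//= set_fsetU1 bigcap_setU1 /C' eqxx.
  rewrite (_ : \bigcap_(n in [set` J]) _ = E0); last first.
    by apply: eq_bigcapr => n /= nJ; rewrite -/(C' n) C'J.
  rewrite (eq_big_seq (fun n => P (xi n @^-1` C n))); last first.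
    by move=> n nJ; rewrite -/(C' n) C'J.
  rewrite -ind// cE => ->; rewrite muleC; congr (_ * _)%E.
  exact: (dist m B mB).
have -> : (\prod_(n <- J) normal_prob 0 1 (C n))%E = c%:E.
  rewrite -cE ind//; apply: eq_bigr => n _; apply/esym.
  exact: (dist n _ (mC n)).
(* The constraint on coordinate [m] goes into the integrand; the one on [J] becomes the density of
   the restricted measure. *)
pose h (x : R) : \bar R := ((\1_(C m) x)%:E * (L x)%:E)%E.
have h0 x : (0 <= h x)%E by rewrite mule_ge0// lee_fin.
have mh : measurable_fun setT h.
  by apply: emeasurable_funM; exact/measurable_EFinP.
transitivity (\int[P]_w (h (xi m w) * (\1_E0 w)%:E))%E.
  rewrite integral_mkcond; apply: eq_integral => w _.
  rewrite set_fsetU1 bigcap_setU1 patchE in_setI -/E0 /h !indicE.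
  rewrite (_ : (w \in _ @^-1` _) = (xi m w \in C m)); last first.
    by apply/idP/idP; rewrite !inE.
  by do 2 case: (_ \in _); rewrite ?mule1 ?mul1e ?mule0 ?mul0e.
rewrite -(@integral_density _ _ _ P (mrestr P mE0) (\1_E0) (h \o xi m))//.
- have mxi : measurable_fun setT (xi m : Omega -> measurableTypeR R).
    by move=> _ B mB; rewrite setTI; exact: mX.
  have := @ge0_integral_pushforward _ _ Omega (measurableTypeR R) R _ mxi
    (mrestr P mE0) setT h measurableT mh.
  rewrite preimage_setT => <-; last by move=> x _; exact: h0.
  transitivity (\int[mscale (NngNum c0) (normal_prob 0 1)]_x h x)%E.
    by apply: eq_measure_integral => B mB _; exact: PB.
  rewrite ge0_integral_mscale//= [in RHS]integral_mkcond.
  congr (_ * _)%E; apply: eq_integral => x _.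
  by rewrite patchE /h indicE; case: ifP; rewrite ?mul1e ?mul0e.
- by move=> A mA; rewrite integral_indic// setIC.
- exact: measurableT_comp.
- by move=> x; exact: h0.
Qed.

(** Both sides integrate [f] against a measure on sequences: the law of the shifted observation
    under [P], and the law of pure noise under the tilted measure [Q]. On a finite rectangle the two
    differ only in the factor of coordinate [m], where [normal_probD] applies. *)
Lemma girsanov (eps b : R) (m : nat) (f : seqspace R -> \bar R) :
  measurable_fun setT f -> (forall y, 0 <= f y)%E ->
  (\int[P]_w f (observation xi eps (spike m (eps * b)%R) w) =
   \int[P]_w (f (observation xi eps (fun=> 0%R) w) *
              (expR (b * xi m w - b ^+ 2 / 2))%:E))%E.
Proof.
move=> mf f0.
pose L (x : R) := expR (b * x - b ^+ 2 / 2).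
have mL : measurable_fun setT L.
  by apply: measurableT_comp => //; apply: measurable_funB => //; exact: measurable_funM.
have mLx : measurable_fun setT (L \o xi m) by exact: measurableT_comp.
have L0 (w : Omega) : 0 <= (L \o xi m) w by exact: expR_ge0.
have m1 := measurable_observation eps (spike m (eps * b)).
have m0 := measurable_observation eps (fun=> 0).
pose Q := density P mLx L0.
have <- := @integral_density _ _ _ P Q (L \o xi m)
  (f \o (observation xi eps (fun=> 0))) mLx L0 (fun _ _ => erefl)
  (measurableT_comp mf m0) (fun x => f0 _).
have := @ge0_integral_pushforward _ _ Omega (seqspace R) R _ m1 P setT f
  measurableT mf.
rewrite preimage_setT => <-; last by move=> x _; exact: f0.
have := @ge0_integral_pushforward _ _ Omega (seqspace R) R _ m0 Q setT f
  measurableT mf.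
rewrite preimage_setT => <-; last by move=> x _; exact: f0.
apply: eq_measure_integral => A mA _.
move: A mA; apply: seqspace_measure_unique.
  by rewrite /= /pushforward preimage_setT probability_setT ltry.
move=> _ [J [B [mB BT ->]]].
rewrite /= /pushforward /Q /density.
pose C n := [set x : R | B n (eps * x)].
pose C1 n := [set x : R | B n (spike m (eps * b) n + eps * x)].
have mC n : measurable (C n).
  rewrite -[C n]setTI; apply: (@measurable_funM _ _ _ setT (cst eps) id) => //.
have mC1 n : measurable (C1 n).
  rewrite -[C1 n]setTI.
  apply: (@measurable_funD _ _ _ setT (cst _) (fun x => eps * x)) => //.
  exact: measurable_funM.
(* Writing the index set as [m] added to [J'] isolates the shifted coordinate; if [m] was not in
   [J], its constraint is [setT]. *)
pose J' := (J `\ m)%fset.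
have mJ' : m \notin J' by rewrite !inE eqxx.
have evE (eta : nat -> R) : observation xi eps eta @^-1` [set y | forall n, B n (y n)] =
    \bigcap_(n in [set` (m |` J')%fset]) (xi n @^-1`
       [set x : R | B n (eta n + eps * x)]).
  apply/seteqP; split => [w /= wB n _|w /= wB n]; first exact: wB.
  have [nJ|nJ] := boolP (n \in (m |` J')%fset); first exact: (wB n).
  rewrite BT//; apply: contra nJ => nJ.
  by rewrite !inE nJ andbT orbN.
rewrite !evE.
rewrite (_ : \bigcap_(n in _) (xi n @^-1` [set x | B n (0 + eps * x)]) =
  \bigcap_(n in [set` (m |` J')%fset]) (xi n @^-1` C n)); last first.
  by apply: eq_bigcapr => n _; rewrite /C; under eq_set do rewrite add0r.
rewrite (iid_integral (L := L))//; last by move=> x; exact: expR_ge0.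
rewrite -[X in _ = (_ * X)%E](normal_probD b (mC m)).
transitivity (\int[P]_(w in \bigcap_(n in [set` (m |` J')%fset])
   (xi n @^-1` C1 n)) (cst 1 (xi m w))%:E)%E.
  rewrite -[RHS]/(\int[P]_(w in _) cst 1%E w)%E integral_cst ?mul1e//.
  apply: fin_bigcap_measurable => // n _.
  by rewrite -[X in measurable X]setTI; exact: measurable_funP.
rewrite (iid_integral (L := cst 1))//.
rewrite -[X in (_ * X)%E = _]/(\int[_]_(x in _) cst 1%E x)%E.
rewrite integral_cst//; last exact: mC1.
rewrite mul1e; congr (_ * _)%E.
  apply: eq_big_seq => n nJ; congr (normal_prob 0 1 _); rewrite /C1 /C /spike.
  move: nJ; rewrite !inE => /andP[/negbTE -> _].
  by under eq_set do rewrite add0r.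
congr (normal_prob 0 1 _); rewrite /C1 /C /spike eqxx.
by apply/seteqP; split => x /=; rewrite mulrDr addrC.
Qed.

End shift.

(** * Bayes risk for a uniform prior on spikes *)

Section ge0_mean.
Context (d : measure_display) (T : measurableType d) (R : realType)
  (P : probability T R).

(** Bundles what additivity and monotonicity of the integral require, so that expectations can be
    combined as real numbers. Only nonnegative combinations preserve it, hence no differences
    below. *)
Definition ge0_mean (g : T -> R) (v : R) : Prop :=
  [/\ measurable_fun setT g, forall w, 0 <= g w &
      (\int[P]_w (g w)%:E = v%:E)%E].

Lemma ge0_mean_cst (c : R) : 0 <= c -> ge0_mean (cst c) c.
Proof.
move=> c0; split => //.
rewrite -[LHS]/(\int[P]_w cst c%:E w)%E integral_cst//.
rewrite -[RHS]mule1; congr (_ * _)%E; exact: (probability_setT P).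
Qed.

Lemma ge0_meanD (f g : T -> R) (u v : R) :
  ge0_mean f u -> ge0_mean g v -> ge0_mean (fun w => f w + g w) (u + v).
Proof.
move=> [mf f0 fu] [mg g0 gv]; split => [|w|]; first exact: measurable_funD.
  by rewrite addr_ge0.
rewrite EFinD -fu -gv -ge0_integralD//.
- by move=> w _; rewrite lee_fin.
- exact/measurable_EFinP.
- by move=> w _; rewrite lee_fin.
- exact/measurable_EFinP.
Qed.

Lemma ge0_meanZ (c : R) (f : T -> R) (u : R) : 0 <= c ->
  ge0_mean f u -> ge0_mean (fun w => c * f w) (c * u).
Proof.
move=> c0 [mf f0 fu]; split => [|w|]; first exact: measurable_funM.
  by rewrite mulr_ge0.
under eq_integral do rewrite EFinM.
rewrite ge0_integralZl//; last by move=> w _; rewrite lee_fin.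
  by rewrite fu.
exact/measurable_EFinP.
Qed.

Lemma ge0_mean_sum (I : Type) (s : seq I) (f : I -> T -> R) (u : I -> R) :
  (forall i, ge0_mean (f i) (u i)) ->
  ge0_mean (fun w => \sum_(i <- s) f i w) (\sum_(i <- s) u i).
Proof.
move=> fu; elim: s => [|i s IHs].
  rewrite big_nil (_ : (fun _ => _) = cst 0); first exact: ge0_mean_cst.
  by apply/funext => w; rewrite big_nil.
rewrite big_cons (_ : (fun _ => _) = fun w => f i w + \sum_(i <- s) f i w).
  exact: ge0_meanD.
by apply/funext => w; rewrite big_cons.
Qed.

Lemma ge0_mean_le (f g : T -> R) (u v : R) :
  ge0_mean f u -> ge0_mean g v -> (forall w, f w <= g w) -> u <= v.
Proof.
move=> [mf f0 fu] [mg g0 gv] fg; rewrite -lee_fin -fu -gv.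
apply: ge0_le_integral => //; try exact/measurable_EFinP.
- by move=> w _; rewrite lee_fin f0.
- by move=> w _; rewrite lee_fin fg.
Qed.

Lemma ge0_mean_fun_eq (f g : T -> R) (u : R) :
  f =1 g -> ge0_mean f u -> ge0_mean g u.
Proof. by move=> /funext ->. Qed.

End ge0_mean.

Section likelihood.
Context (R : realType) (d : measure_display) (Omega : measurableType d)
  (P : probability Omega R) (xi : nat -> {RV P >-> R}).

Lemma mean_ge0_mean (eps : R) (eta : nat -> R) (f : seqspace R -> R) :
  measurable_fun setT f -> (forall y, 0 <= f y <= 1) ->
  ge0_mean P (fun w => f (observation xi eps eta w)) (mean xi eps eta f).
Proof.
move=> mf f01.
have mfo : measurable_fun setT (fun w => f (observation xi eps eta w)).
  exact: measurableT_comp mf (measurable_observation xi eps eta).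
have f0 y : 0 <= f y by have /andP[] := f01 y.
split => //; rewrite /mean unlock fineK// ge0_fin_numE; last first.
  by apply: integral_ge0 => w _; rewrite lee_fin.
apply: (@le_lt_trans _ _ 1%E); last by rewrite ltry.
have [_ _ <-] := ge0_mean_cst P ler01.
apply: ge0_le_integral => //; try exact/measurable_EFinP.
- by move=> w _; rewrite lee_fin.
- by move=> w _; rewrite lee_fin; have /andP[] := f01 (observation xi eps eta w).
Qed.

Lemma mean_01 (eps : R) (eta : nat -> R) (f : seqspace R -> R) :
  measurable_fun setT f -> (forall y, 0 <= f y <= 1) ->
  0 <= mean xi eps eta f <= 1.
Proof.
move=> mf f01; have E := mean_ge0_mean eps eta mf f01.
apply/andP; split.
  apply: (ge0_mean_le (ge0_mean_cst P (lexx 0)) E) => w /=.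
  by have /andP[] := f01 (observation xi eps eta w).
apply: (ge0_mean_le E (ge0_mean_cst P ler01)) => w /=.
by have /andP[] := f01 (observation xi eps eta w).
Qed.

Hypothesis iid_xi : iid_standard_normal xi.

Definition likelihood (b : R) (m : nat) (w : Omega) : R :=
  expR (b * xi m w - b ^+ 2 / 2).

Lemma girsanov_mean (eps b : R) (m : nat) (f : seqspace R -> R) (v : R) :
  measurable_fun setT f -> (forall y, 0 <= f y) ->
  ge0_mean P (fun w => f (observation xi eps (spike m (eps * b)) w)) v ->
  ge0_mean P (fun w => f (observation xi eps (fun=> 0) w) * likelihood b m w) v.
Proof.
move=> mf f0 [_ _ fv]; split.
- apply: measurable_funM.
    exact: measurableT_comp mf (measurable_observation xi eps _).
  apply: measurableT_comp => //; apply: measurable_funB => //.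
  exact: measurable_funM.
- by move=> w; rewrite mulr_ge0 ?expR_ge0.
- rewrite -fv (girsanov iid_xi eps b m (f := EFin \o f))//=.
    exact/measurable_EFinP.
Qed.

Lemma likelihood_mean (b : R) (m : nat) : ge0_mean P (likelihood b m) 1.
Proof.
have := @girsanov_mean 1 b m (cst 1) 1 (measurable_cst _) (fun=> ler01)
  (ge0_mean_cst P ler01).
by apply: ge0_mean_fun_eq => w /=; rewrite mul1r.
Qed.

(** The weight [likelihood b j] shifts the noise of coordinate [j] by [b]. This leaves the mean of
    [likelihood b i] equal to 1 if [i] differs from [j], and multiplies it by [expR (b ^+ 2)]
    otherwise. *)
Lemma likelihood2_mean (b : R) (i j : nat) :
  ge0_mean P (fun w => likelihood b i w * likelihood b j w)
    (if i == j then expR (b ^+ 2) else 1).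
Proof.
pose f (y : seqspace R) := expR (b * y i - b ^+ 2 / 2).
have mf : measurable_fun setT f.
  apply: measurableT_comp => //; apply: measurable_funB => //.
  apply: measurable_funM => //; exact: measurable_coord.
have := @girsanov_mean 1 b j f (if i == j then expR (b ^+ 2) else 1) mf
  (fun=> expR_ge0 _).
rewrite /f /observation => H; apply: ge0_mean_fun_eq; last apply: H.
  by move=> w /=; rewrite add0r mul1r.
rewrite /spike; case: eqVneq => [->|ij].
  rewrite -[X in ge0_mean _ _ X]mulr1.
  apply: ge0_mean_fun_eq (ge0_meanZ (expR_ge0 (b ^+ 2)) (likelihood_mean b j)).
  move=> w; rewrite /likelihood !mul1r -expRD; congr expR.
  by field.
by apply: ge0_mean_fun_eq (likelihood_mean b i) => w; rewrite add0r mul1r.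
Qed.

(** [(expR (b ^+ 2) - 1) / N%:R] is the null variance of the mixture likelihood ratio: only the [N]
    diagonal pairs of spikes are correlated. Once it is at most [lam ^+ 2], the total loss is at
    most [lam]. *)
Lemma bayes_risk_ge (eps b lam : R) (m0 N : nat) (psi : (nat -> R) -> R) :
  (0 < N)%N -> 0 < lam -> is_test psi ->
  1 - (expR (b ^+ 2) - 1) / N%:R / (2 * lam) - lam / 2 <=
  mean xi eps (fun=> 0) psi + N%:R^-1 * \sum_(i < N)
    mean xi eps (spike (m0 + i) (eps * b)) (fun y => 1 - psi y).
Proof.
move=> N0 lam0 [mpsi psi01].
have mpsi' : measurable_fun setT (fun y : seqspace R => 1 - psi y).
  exact: measurable_funB.
have psi'01 y : 0 <= 1 - psi y <= 1 by have := psi01 y; lra.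
have psi'0 y : 0 <= 1 - psi y by have := psi01 y; lra.
pose s := index_enum 'I_N.
pose x w := N%:R^-1 * \sum_(i <- s) likelihood b (m0 + i) w.
pose y0 w := observation xi eps (fun=> 0) w.
have N0' : 0 <= N%:R^-1 :> R by [].
have xE : ge0_mean P x (N%:R^-1 * \sum_(i <- s) 1).
  by apply: ge0_meanZ => //; apply: ge0_mean_sum => i; exact: likelihood_mean.
have xxE : ge0_mean P (fun w => x w ^+ 2)
    (N%:R^-1 * (N%:R^-1 * \sum_(i <- s) \sum_(j <- s)
       (if (m0 + i == m0 + j)%N then expR (b ^+ 2) else 1))).
  have := ge0_meanZ N0' (ge0_meanZ N0' (ge0_mean_sum s (fun i =>
    ge0_mean_sum s (fun j => likelihood2_mean b (m0 + i) (m0 + j))))).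
  apply: ge0_mean_fun_eq => w; rewrite /x exprMn expr2 -mulrA; congr (_ * (_ * _)).
  rewrite expr2 big_distrl/=; apply: eq_bigr => i _.
  by rewrite big_distrr.
have pE : ge0_mean P (fun w => (1 - psi (y0 w)) * x w)
   (N%:R^-1 * \sum_(i <- s) mean xi eps (spike (m0 + i) (eps * b))
      (fun y => 1 - psi y)).
  have := ge0_meanZ N0' (ge0_mean_sum s (fun i =>
    girsanov_mean mpsi' psi'0 (mean_ge0_mean eps (spike (m0 + i) (eps * b))
      mpsi' psi'01))).
  apply: ge0_mean_fun_eq => w.
  by rewrite /x mulrCA; congr (_ * _); rewrite big_distrr.
have l0 : 0 <= lam^-1 by rewrite invr_ge0 ltW.
have l20 : 0 <= (2 * lam)^-1 by rewrite invr_ge0; lra.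
have c0 : 0 <= lam / 2 + (2 * lam)^-1 by lra.
have L := ge0_meanD (ge0_mean_cst P ler01) (ge0_meanZ l0 xE).
have U := ge0_meanD (ge0_meanD (ge0_meanD
  (mean_ge0_mean eps (fun=> 0) mpsi psi01) pE) (ge0_meanZ l20 xxE))
  (ge0_mean_cst P c0).
have lamN : lam != 0 by rewrite gt_eqF.
have NN : N%:R != 0 :> R by rewrite pnatr_eq0 -lt0n.
have sum1 : \sum_(i <- s) 1 = N%:R :> R by rewrite sumr_const card_ord.
have sum2 : \sum_(i <- s) \sum_(j <- s)
    (if (m0 + i == m0 + j)%N then expR (b ^+ 2) else 1) =
    N%:R * (N%:R + (expR (b ^+ 2) - 1)) :> R.
  rewrite -[X in X * _]sum1 big_distrl/=; apply: eq_bigr => i _; rewrite mul1r.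
  rewrite -sum1 (bigD1 i)//= eqxx [in RHS](bigD1 i)//=.
  rewrite (eq_bigr (fun=> 1)); first by ring.
  by move=> j ji; rewrite eqn_add2l (inj_eq val_inj) eq_sym (negbTE ji).
(* With [x] the mixture likelihood ratio, AM-GM gives
   [psi + (1 - psi) x >= 1 - |1 - x| >= 1 - ((1 - x)^2 / lam + lam) / 2]; the terms
   are arranged so that only nonnegative functions are integrated. *)
have := ge0_mean_le L U; rewrite sum1 sum2.
set A := mean _ _ _ _; set B := \sum_(i <- s) _ => AB.
have {}AB : 1 + lam^-1 * (N%:R^-1 * N%:R) <= A + N%:R^-1 * B +
    (2 * lam)^-1 * (N%:R^-1 * (N%:R^-1 * (N%:R * (N%:R + (expR (b ^+ 2) - 1))))) +
    (lam / 2 + (2 * lam)^-1).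
  apply: AB => w /=.
  have /andP[p0 p1] := psi01 (observation xi eps (fun=> 0) w).
  rewrite -/(y0 w) in p0 p1 *; set p := psi _ in p0 p1 *.
  rewrite -subr_ge0.
  suff -> : p + (1 - p) * x w + (2 * lam)^-1 * x w ^+ 2 +
      (lam / 2 + (2 * lam)^-1) - (1 + lam^-1 * x w) =
      ((1 - x w - lam * (1 - p)) ^+ 2 + lam ^+ 2 * (1 - (1 - p) ^+ 2)) / (2 * lam).
    rewrite divr_ge0//; last lra.
    rewrite addr_ge0 ?sqr_ge0// mulr_ge0 ?sqr_ge0//; nra.
  by field.
rewrite -subr_ge0 in AB; rewrite -subr_ge0; apply: le_trans AB _.
rewrite le_eqVlt; apply/orP; left; apply/eqP.
by field; apply/andP.
Qed.

End likelihood.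

(** * Sums of peaked exponentials and series of nonnegative terms *)

Lemma expR_peak_step (R : realType) (p y : R) : 0 < p -> p <= y -> y <= 1 ->
  (1 - p) * y <= 2 - p / y - y.
Proof.
move=> p0 py y1; have y0 : 0 < y by apply: lt_le_trans py.
rewrite -subr_ge0.
suff -> : 2 - p / y - y - (1 - p) * y = (1 - y) * ((2 - p) * y - p) / y.
  by rewrite divr_ge0 ?(ltW y0)// mulr_ge0 ?subr_ge0//; nra.
by field; rewrite gt_eqF.
Qed.

(* Comparison with a discrete primitive of the peaked exponential. *)
Lemma sum_expR_peak_le (R : realType) (c x : R) (n : nat) : 0 < c ->
  (1 - expR (- c)) * \sum_(0 <= k < n) expR (- (c * `|k%:R - x|)) <= 2.
Proof.
move=> c0; pose p := expR (- c).
have p0 : 0 < p by exact: expR_gt0.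
have p1 : p < 1 by rewrite -expR0 ltr_expR oppr_lt0.
(* The primitive of [c * expR (- (c * |t|))] vanishing at minus infinity; its total increase is the
   bound 2. *)
pose F (t : R) := if t <= 0 then expR (c * t) else 2 - expR (- (c * t)).
have F0 t : 0 <= F t <= 2.
  rewrite /F; case: (leP t 0) => t0.
    have : expR (c * t) <= 1 by rewrite -expR0 ler_expR; nra.
    by have := expR_ge0 (c * t); lra.
  have e0 := expR_ge0 (- (c * t)).
  have : expR (- (c * t)) <= 1 by rewrite -expR0 ler_expR; nra.
  lra.
have FS t : (1 - p) * expR (- (c * `|t|)) <= F (t + 1) - F t.
  rewrite /F; case: (leP t 0) => t0.
    rewrite ler0_norm// mulrN opprK; case: (leP (t + 1) 0) => t1.
      rewrite mulrDr mulr1 expRD.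
      have -> : expR c = p^-1 by rewrite /p expRN invrK.
      rewrite -/p -subr_ge0; set e := expR (c * t).
      suff -> : e * p^-1 - e - (1 - p) * e = e * (1 - p) ^+ 2 / p.
        by rewrite divr_ge0 ?(ltW p0)// mulr_ge0 ?sqr_ge0 ?expR_ge0.
      by field; rewrite gt_eqF.
    (* The unit step crosses the peak; [expR_peak_step] applies with [y = expR (c * t)]. *)
    rewrite mulrDr mulr1 opprD expRD -/p [X in 2 - X]mulrC expRN.
    apply: expR_peak_step => //.
      by rewrite ler_expR; nra.
    by rewrite -expR0 ler_expR; nra.
  rewrite gtr0_norm//; case: (leP (t + 1) 0) => t1; first by lra.
  by rewrite mulrDr mulr1 opprD expRD -/p; lra.
suff H : (1 - p) * \sum_(0 <= k < n) expR (- (c * `|k%:R - x|)) <= F (n%:R - x).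
  by apply: le_trans H _; have /andP[] := F0 (n%:R - x).
elim: n => [|n IHn]; first by rewrite big_geq// mulr0; have /andP[] := F0 (0 - x).
rewrite big_nat_recr//= mulrDr.
have := FS (n%:R - x); rewrite addrAC -natr1; lra.
Qed.

Lemma nneseries_le_fin (R : realType) (u : nat -> R) (c : R) :
  (forall n, 0 <= u n) -> (forall n, \sum_(0 <= k < n) u k <= c) ->
  (\sum_(0 <= n <oo) (u n)%:E <= c%:E)%E.
Proof.
move=> u0 uc; apply: lime_le.
  by apply: is_cvg_nneseries => n _ _; rewrite lee_fin.
by apply: nearW => n; rewrite sumEFin lee_fin.
Qed.

Lemma nneseries_ge_term (R : realType) (u : nat -> R) (m : nat) :
  (forall n, 0 <= u n) -> ((u m)%:E <= \sum_(0 <= n <oo) (u n)%:E)%E.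
Proof.
move=> u0; apply: le_trans (nneseries_lim_ge m.+1 _); last first.
  by move=> n _ _; rewrite lee_fin.
rewrite sumEFin lee_fin big_nat_recr//= lerDr.
by rewrite sumr_ge0.
Qed.

Lemma nneseries_single (R : realType) (u : nat -> R) (m : nat) :
  0 <= u m -> (forall n, n != m -> u n = 0) ->
  (\sum_(0 <= n <oo) (u n)%:E = (u m)%:E)%E.
Proof.
move=> um0 um; have u0 n : 0 <= u n.
  by have [->//|nm] := eqVneq n m; rewrite um.
rewrite (@nneseriesD1 _ _ m)//; last by move=> n _; rewrite lee_fin.
by rewrite eseries0 ?adde0// => n _ /um ->.
Qed.

(** * Exponential ellipsoids *)

Section ellipsoid.
Context (R : realType) (kappa : R * R * R).
Let a := alpha_of kappa.
Let be := beta_of kappa.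
Let q := q_of kappa.
Hypotheses (a0 : 0 < a) (be0 : 0 < be) (q02 : 0 < q <= 2).
Let s := a + be.
Let s0 : 0 < s. Proof. exact: addr_gt0. Qed.
Let one_powR : 1 `^ q = 1 :> R. Proof. by rewrite powR1. Qed.
Local Notation Theta r := (Theta (exp_ellipsoids R) kappa r).

Lemma Theta_weighted_le1 r (eta : nat -> R) n : Theta r eta ->
  expR (s * n.+1%:R) * `|eta n| <= 1.
Proof.
move=> [_ + _] => /= H.
have {}H : (`|expR (a * n.+1%:R) * expR (be * n.+1%:R) * eta n| `^ q <= 1).
  rewrite -lee_fin; apply: le_trans H.
  apply: (@nneseries_ge_term _ (fun n =>
    `|expR (a * n.+1%:R) * expR (be * n.+1%:R) * eta n| `^ q)).
  by move=> k; exact: powR_ge0.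
move: H; rewrite -expRD -mulrDl -/s normrM (ger0_norm (expR_ge0 _)).
set y := _ * _ => yq; rewrite leNgt; apply/negP => y1.
move: yq; apply/negP; rewrite -ltNge -[ltLHS]one_powR.
apply: gt0_ltr_powR; rewrite ?nnegrE ?ler01 ?(ltW (lt_trans ltr01 y1))//.
by case/andP: q02.
Qed.

Lemma Theta_coord_le r (eta : nat -> R) n : Theta r eta ->
  `|eta n| <= expR (- (s * n.+1%:R)).
Proof.
move=> /(@Theta_weighted_le1 _ _ n).
by rewrite expRN -[X in _ -> _ <= X]mul1r ler_pdivlMr ?expR_gt0// mulrC.
Qed.

(** With y the weighted coordinate [expR (s * n.+1%:R) * |eta n|], the energy term is y^2 times a
    factor at most exp(-2a), and y^2 is at most y^q because y <= 1 and q <= 2; the q-sum is at most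
    1. *)
Lemma Theta_radius_le r (eta : nat -> R) : 0 < r -> Theta r eta ->
  r <= expR (- a).
Proof.
move=> r0 T; have [_ E1 /= E2] := T.
rewrite -(@ler_pXn2r _ 2) ?nnegrE ?(ltW r0) ?expR_ge0//.
rewrite -lee_fin; apply: (le_trans E2).
apply: (@le_trans _ _ (\sum_(0 <= n <oo) ((expR (- a) ^+ 2)%:E *
  (`|expR (a * n.+1%:R) * expR (be * n.+1%:R) * eta n| `^ q)%:E)))%E.
  apply: lee_nneseries => [n _ _|n _]; first by rewrite lee_fin mulr_ge0 ?sqr_ge0.
  rewrite -EFinM lee_fin.
  have y1 := Theta_weighted_le1 n T.
  rewrite -expRD -mulrDl -/s normrM (ger0_norm (expR_ge0 _)).
  set y := _ * _ in y1 *.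
  have y0 : 0 <= y by rewrite mulr_ge0 ?expR_ge0.
  apply: (@le_trans _ _ (expR (- a) ^+ 2 * y ^+ 2)); last first.
    rewrite ler_wpM2l ?sqr_ge0//.
    have [->|yn0] := eqVneq y 0; first by rewrite expr0n powR_ge0.
    rewrite -powR_mulrn//; apply: ger_powR; last by case/andP: q02.
    by rewrite lt_neqAle eq_sym yn0 y0.
  rewrite /y -!exprMn -(@real_normK _ (expR (be * n.+1%:R) * eta n)) ?num_real//.
  rewrite normrM (ger0_norm (expR_ge0 _)).
  rewrite ler_pXn2r ?nnegrE ?mulr_ge0 ?expR_ge0// mulrA ler_wpM2r// -expRD ler_expR.
  by have := mulr_ge0 (ltW a0) (ler0n R n); rewrite /s -natr1; lra.
rewrite nneseriesZl; last by move=> n _; rewrite lee_fin powR_ge0.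
by rewrite -[leRHS]mule1 lee_wpmul2l// lee_fin sqr_ge0.
Qed.

(** The two bounds on the coordinates cross at [x], where exp(-s x) = M. Below [x] the bound by [M]
    lets the weighted squares grow at rate [2 * be]; above it the ellipsoid makes them decay at rate
    [2 * a]. Both rates are at least [2 * del], and the peak value is exp(-2 a x), which is the
    power of [M] in the statement. *)
Lemma ellipsoid_sum_le (del M : R) (eta : nat -> R) :
  0 < del -> del <= a -> del <= be -> 0 < M ->
  (forall n, `|eta n| <= M) ->
  (forall n, `|eta n| <= expR (- (s * n.+1%:R))) ->
  (\sum_(0 <= n <oo) (expR (be * n.+1%:R) ^+ 2 * eta n ^+ 2)%:E <=
   (2 / (1 - expR (- (2 * del))) * M `^ (2 * a / s))%:E)%E.
Proof.
move=> del0 dela delb M0 etaM etas.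
pose x := - ln M / s.
have p1 : expR (- (2 * del)) < 1 by rewrite -[ltRHS]expR0 ltr_expR; lra.
have ME : M = expR (- (s * x)).
  by rewrite /x mulrC divfK ?gt_eqF// opprK lnK.
have -> : M `^ (2 * a / s) = expR (- (2 * a * x)).
  by rewrite /powR gt_eqF// ME expRK; congr expR; field; rewrite gt_eqF.
apply: nneseries_le_fin => [n|N]; first by rewrite mulr_ge0 ?sqr_ge0.
have term n : expR (be * n.+1%:R) ^+ 2 * eta n ^+ 2 <=
    expR (- (2 * a * x)) * expR (- (2 * del * `|n%:R - (x - 1)|)).
  rewrite -exprMn -(@real_normK _ (_ * _)) ?num_real// normrM (ger0_norm (expR_ge0 _)).
  rewrite -expRD.
  (* Entry [n] is coordinate [n.+1], so in terms of [n] the peak sits at [x - 1]. *)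
  have -> : n%:R - (x - 1) = n.+1%:R - x by rewrite -natr1; ring.
  set k := n.+1%:R.
  have [kx|xk] := lerP k x.
    apply: (@le_trans _ _ ((expR (be * k) * M) ^+ 2)).
      by rewrite ler_pXn2r ?nnegrE ?mulr_ge0 ?expR_ge0 ?(ltW M0)// ler_wpM2l ?expR_ge0.
    rewrite ME -!expRD -expRM_natl ler_expR /s; nra.
  apply: (@le_trans _ _ ((expR (be * k) * expR (- (s * k))) ^+ 2)).
    by rewrite ler_pXn2r ?nnegrE ?mulr_ge0 ?expR_ge0// ler_wpM2l ?expR_ge0 ?etas.
  rewrite -!expRD -expRM_natl ler_expR /s; nra.
apply: (le_trans (ler_sum _ (fun n _ => term n))).
rewrite -big_distrr/= mulrC ler_wpM2r ?expR_ge0//.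
rewrite ler_pdivlMr ?subr_gt0// mulrC.
by apply: sum_expR_peak_le; rewrite mulr_gt0.
Qed.

Lemma spike_Theta r m z : 0 <= r -> 0 <= z -> expR (s * m.+1%:R) * z <= 1 ->
  r <= expR (be * m.+1%:R) * z -> Theta r (spike m z).
Proof.
move=> r0 z0 z1 rz; have q0 : q != 0 by rewrite gt_eqF//; case/andP: q02.
split => /=; rewrite /spike.
- rewrite (@nneseries_single _ (fun n => (if n == m then z else 0) ^+ 2) m)
    ?sqr_ge0 ?ltry//.
  by move=> n /negbTE ->; rewrite expr0n.
- rewrite (@nneseries_single _ (fun n => `|expR (a * n.+1%:R) *
    expR (be * n.+1%:R) * (if n == m then z else 0)| `^ q) m) ?powR_ge0//; last first.
    by move=> n /negbTE ->; rewrite mulr0 normr0 powR0.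
  rewrite eqxx lee_fin -expRD -mulrDl ger0_norm ?mulr_ge0 ?expR_ge0//.
  rewrite -[leRHS]one_powR; apply: ge0_ler_powR; rewrite ?nnegrE ?mulr_ge0 ?expR_ge0//.
  by case/andP: q02 => /ltW.
- rewrite (@nneseries_single _ (fun n => expR (be * n.+1%:R) ^+ 2 *
    (if n == m then z else 0) ^+ 2) m); first 1 last.
  + by rewrite -exprMn sqr_ge0.
  + by move=> n /negbTE ->; rewrite expr0n mulr0.
  + by rewrite eqxx lee_fin -exprMn ler_pXn2r ?nnegrE ?mulr_ge0 ?expR_ge0.
Qed.

End ellipsoid.

(** * From the quartic functional to single coordinates *)

Section u_eps_bounds.
Context (R : realType) (K : Type) (F : ellipsoids R K) (kappa : K) (eps r : R).
Hypothesis eps0 : 0 < eps.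

Let sum4 (eta : nat -> R) : \bar R := (\sum_(0 <= n <oo) (eta n ^+ 4)%:E)%E.

(** The exact factor 1/sqrt(2) is rounded up to 1 here and down to 1/2 in [u_eps_ge_coord], to keep
    square roots out. *)
Lemma u_eps_le_spike (m : nat) (z : R) :
  Theta F kappa r (spike m z) -> (u_eps F eps kappa r <= (z ^+ 2 / eps ^+ 2)%:E)%E.
Proof.
move=> T.
have zz : 0 <= z ^+ 2 / eps ^+ 2 by rewrite divr_ge0 ?sqr_ge0.
rewrite -[X in (_ <= X%:E)%E](ger0_norm zz) -sqrtr_sqr.
rewrite -[leRHS]/(sqrte ((z ^+ 2 / eps ^+ 2) ^+ 2)%:E) lee_sqrt ?lee_fin ?sqr_ge0//.
apply: (@le_trans _ _ (((2 * eps ^+ 4)^-1)%:E * sum4 (spike m z))%E).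
  rewrite lee_wpmul2l ?lee_fin ?invr_ge0 ?mulr_ge0 ?exprn_ge0 ?(ltW eps0)//.
  by apply: ereal_inf_lbound; exists (spike m z).
rewrite /sum4 (@nneseries_single _ (fun n => spike m z n ^+ 4) m) /spike; first 1 last.
- by rewrite exprn_even_ge0.
- by move=> n /negbTE ->; rewrite expr0n.
rewrite eqxx -EFinM lee_fin.
have -> : (2 * eps ^+ 4)^-1 * z ^+ 4 = (z ^+ 2 / eps ^+ 2) ^+ 2 / 2.
  by field; rewrite gt_eqF.
by have := sqr_ge0 (z ^+ 2 / eps ^+ 2); lra.
Qed.

Lemma u_eps_ge_coord (M : R) : 0 <= M ->
  (forall eta, Theta F kappa r eta -> exists n, M <= `|eta n|) ->
  ((M ^+ 2 / (2 * eps ^+ 2))%:E <= u_eps F eps kappa r)%E.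
Proof.
move=> M0 etaM.
have zz : 0 <= M ^+ 2 / (2 * eps ^+ 2).
  by rewrite divr_ge0 ?sqr_ge0// mulr_ge0 ?sqr_ge0.
rewrite -[X in (X%:E <= _)%E](ger0_norm zz) -sqrtr_sqr.
rewrite -[leLHS]/(sqrte ((M ^+ 2 / (2 * eps ^+ 2)) ^+ 2)%:E).
have infM : ((M ^+ 4)%:E <= ereal_inf [set sum4 eta | eta in Theta F kappa r])%E.
  apply: le_ereal_inf_tmp => _ [eta /etaM[n Mn] <-].
  apply: le_trans (nneseries_ge_term (u := fun n => eta n ^+ 4) n _).
    rewrite lee_fin -[eta n ^+ 4]ger0_norm ?exprn_even_ge0// normrX.
    by rewrite ler_pXn2r ?nnegrE.
  by move=> k; rewrite exprn_even_ge0.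
have e0 : (0 <= ((2 * eps ^+ 4)^-1)%:E)%E.
  by rewrite lee_fin invr_ge0 mulr_ge0 ?exprn_ge0 ?(ltW eps0).
rewrite /u_eps lee_sqrt; last first.
  by rewrite mule_ge0// (le_trans _ infM)// lee_fin exprn_ge0.
apply: (@le_trans _ _ (((2 * eps ^+ 4)^-1)%:E * (M ^+ 4)%:E)%E); last first.
  by rewrite lee_wpmul2l.
rewrite -EFinM lee_fin.
have -> : (2 * eps ^+ 4)^-1 * M ^+ 4 = 2 * (M ^+ 2 / (2 * eps ^+ 2)) ^+ 2.
  by field; rewrite gt_eqF.
by have := sqr_ge0 (M ^+ 2 / (2 * eps ^+ 2)); lra.
Qed.

(** The infimum may not be attained, whence the margin between [w] and [w']. A nearly minimal [eta]
    has a small quartic sum, which bounds each of its coordinates. *)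
Lemma u_eps_le_Theta (w w' : R) : w < w' ->
  (u_eps F eps kappa r <= w%:E)%E ->
  exists2 eta, Theta F kappa r eta & forall n, `|eta n| <= eps * Num.sqrt (2 * w').
Proof.
move=> ww' uw.
have w0 : 0 <= w by rewrite -lee_fin (le_trans (sqrte_ge0 _) uw).
have e4 : 0 < 2 * eps ^+ 4 by rewrite mulr_gt0 ?exprn_gt0.
have : (((2 * eps ^+ 4)^-1)%:E * ereal_inf [set sum4 eta | eta in Theta F kappa r]
    <= (w ^+ 2)%:E)%E.
  rewrite -lee_sqrt; last by rewrite lee_fin sqr_ge0.
  by apply: (le_trans uw); rewrite /= lee_fin sqrtr_sqr ler_norm.
move=> infle.
have inflt : (ereal_inf [set sum4 eta | eta in Theta F kappa r] <
    (2 * eps ^+ 4 * w' ^+ 2)%:E)%E.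
  rewrite ltNge; apply/negP => infge; move: infle; apply/negP; rewrite -ltNge.
  apply: (@lt_le_trans _ _ (((2 * eps ^+ 4)^-1)%:E * (2 * eps ^+ 4 * w' ^+ 2)%:E)%E).
    rewrite -EFinM mulKf ?gt_eqF// lte_fin ltr_pXn2r// nnegrE.
    by rewrite (le_trans w0)// ltW.
  by rewrite lee_wpmul2l// lee_fin invr_ge0 ltW.
have [_ [eta T <-] sumlt] := ereal_inf_lt inflt.
exists eta => // n.
have w'0 : 0 <= w' by rewrite (le_trans w0)// ltW.
rewrite -(@ler_pXn2r _ 4) ?nnegrE ?mulr_ge0 ?sqrtr_ge0 ?(ltW eps0)//.
rewrite -lee_fin -normrX ger0_norm ?exprn_even_ge0//.
apply: le_trans (nneseries_ge_term (u := fun n => eta n ^+ 4) n _) _.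
  by move=> k; rewrite exprn_even_ge0.
apply: (le_trans (ltW sumlt)); rewrite lee_fin exprMn.
have -> : Num.sqrt (2 * w') ^+ 4 = (2 * w') ^+ 2.
  by rewrite (exprM _ 2 2) sqr_sqrtr// mulr_ge0.
have := mulr_ge0 (exprn_ge0 4 (ltW eps0)) (sqr_ge0 w'); nra.
Qed.

End u_eps_bounds.

(** * Bounds uniform over bounded parameters *)

Section uniform_bounds.
Context (R : realType) (del B : R).
Hypothesis del0 : 0 < del.

(** What is retained of the compactness of Sigma: the later constants depend on kappa only through
    [del] and [B]. *)
Definition bounded_params (kappa : R * R * R) : Prop :=
  [/\ del <= alpha_of kappa <= B, del <= beta_of kappa <= B & 0 < q_of kappa <= 2].

(* Chosen so that the constant [K = 2 / (1 - exp (- 2 del))] of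
   [ellipsoid_sum_le] satisfies [K * peak_const `^ (2 alpha / (alpha + beta)) < 1]
   for all bounded parameters. *)
Definition peak_const : R :=
  (4 / (1 - expR (- (2 * del)))) `^ (- (2 * B / del)).

Lemma peak_const_gt0 : 0 < peak_const.
Proof.
apply: powR_gt0; rewrite divr_gt0// subr_gt0 -[ltRHS]expR0 ltr_expR.
by rewrite oppr_lt0 mulr_gt0.
Qed.

Context (kappa : R * R * R).
Hypothesis adm : bounded_params kappa.
Local Notation a := (alpha_of kappa).
Local Notation be := (beta_of kappa).
Let s := a + be.
Let a0 : 0 < a. Proof. by have [/andP[+ _] _ _] := adm; exact: lt_le_trans. Qed.
Let be0 : 0 < be. Proof. by have [_ /andP[+ _] _] := adm; exact: lt_le_trans. Qed.
Let q02 : 0 < q_of kappa <= 2. Proof. by have [] := adm. Qed.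
Let s0 : 0 < s. Proof. exact: addr_gt0. Qed.
Let s2B : s <= 2 * B.
Proof. by rewrite /s; have [/andP[_ ?] /andP[_ ?] _] := adm; lra. Qed.

(** If every coordinate were below the bound M, [ellipsoid_sum_le] would give r^2 <= K M^(2a/s). The
    exponents cancel, leaving r^2 times a constant below 1. *)
Lemma Theta_large_coord (r : R) (eta : nat -> R) : 0 < r ->
  Theta (exp_ellipsoids R) kappa r eta ->
  exists n, peak_const * r `^ (s / a) <= `|eta n|.
Proof.
move=> r0 T; have [_ _ rT] := T.
apply/not_existsP => H.
have [/andP[dela aB] /andP[delb bB] _] := adm.
set M := peak_const * r `^ (s / a) in H.
have M0 : 0 < M by rewrite mulr_gt0 ?peak_const_gt0 ?powR_gt0.
have := @ellipsoid_sum_le R kappa a0 be0 del M eta del0 dela delb M0.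
move=> /(_ _ _)/(le_trans rT); rewrite lee_fin -/s => /(_ _ _).
have e1 : 0 < 1 - expR (- (2 * del)).
  by rewrite subr_gt0 -[ltRHS]expR0 ltr_expR oppr_lt0 mulr_gt0.
have e2 : 1 - expR (- (2 * del)) < 1 by have := expR_gt0 (- (2 * del)); lra.
suff : ~ r ^+ 2 <= 2 / (1 - expR (- (2 * del))) * M `^ (2 * a / s).
  move=> N {}H'; apply: N; apply: H' => n; last exact: Theta_coord_le T.
  by have /negP := H n; rewrite -ltNge => /ltW.
apply/negP; rewrite -ltNge.
rewrite /M powRM ?powR_ge0 ?(ltW peak_const_gt0)// -powRrM.
have -> : s / a * (2 * a / s) = 2%:R.
  by field; rewrite !gt_eqF.
rewrite powR_mulrn ?(ltW r0)// mulrA -[ltRHS]mul1r ltr_pM2r ?exprn_gt0//.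
rewrite /peak_const -powRrM.
set y := 4 / _.
have y2 : 2 / (1 - expR (- (2 * del))) = y / 2 by rewrite /y; field; rewrite gt_eqF.
have y4 : 4 <= y by rewrite /y ler_pdivlMr//; nra.
rewrite y2.
(* From [del <= a] and [s <= 2 * B]. Hence [peak_const] raised to [2 * a / s] is at most [y^-1], and
   against the factor [y / 2] it leaves at most 1/2. *)
have T1 : 1 <= (2 * B / del) * (2 * a / s).
  have -> : (2 * B / del) * (2 * a / s) = (2 * B * (2 * a)) / (del * s).
    by field; rewrite !gt_eqF.
  rewrite ler_pdivlMr ?mulr_gt0// mul1r.
  have h1 := ler_wpM2r (ltW s0) dela; have h2 := ler_wpM2l (ltW a0) s2B.
  by have h3 := mulr_ge0 (ltW a0) (le_trans (ltW a0) aB); lra.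
have yle : y `^ (- (2 * B / del) * (2 * a / s)) <= y^-1.
  rewrite -[leRHS]powR_inv1; last by lra.
  by apply: ler_powR; [lra|rewrite mulNr lerN2].
apply: (@le_lt_trans _ _ (y / 2 * y^-1)).
  by rewrite ler_wpM2l//; lra.
have -> : y / 2 * y^-1 = 2^-1 by field; rewrite gt_eqF//; lra.
lra.
Qed.

Lemma powR_rate_inv (r z : R) : 0 < r -> 0 <= z -> r `^ (s / a) <= z ->
  r <= z `^ (a / s).
Proof.
move=> r0 z0 rz.
have -> : r = (r `^ (s / a)) `^ (a / s).
  rewrite -powRrM (_ : s / a * (a / s) = 1) ?powRr1 ?(ltW r0)//.
  by field; rewrite !gt_eqF.
by apply: ge0_ler_powR; rewrite ?nnegrE ?powR_ge0// divr_ge0// ltW.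
Qed.

(** Write r = exp(-a x). The spike of height exp(-s k) at coordinate k = floor(x) lies on the
    boundary of the ellipsoid and has norm exp(-a k) >= r. The condition on [r] makes k at least 1,
    and rounding costs at most exp(s) <= exp(2B). *)
Lemma u_eps_upper (eps r : R) : 0 < eps -> 0 < r <= expR (- a) ->
  (u_eps (exp_ellipsoids R) eps kappa r <=
   ((expR (2 * B) * r `^ (s / a)) ^+ 2 / eps ^+ 2)%:E)%E.
Proof.
move=> eps0 /andP[r0 ra].
have a0' := a0.
pose x := - ln r / a.
have lnr : ln r = - (a * x) by rewrite /x; field; rewrite gt_eqF.
have x1 : 1 <= x.
  by rewrite /x ler_pdivlMr// mul1r lerNr -[leRHS](expRK) ler_ln ?posrE ?expR_gt0.
have /andP[kx xk] := truncn_itv (le_trans ler01 x1).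
set k := Num.truncn x in kx xk.
have k0 : (0 < k)%N by rewrite lt0n; apply/eqP => k0; move: xk; rewrite k0; lra.
have kE : k = k.-1.+1 by rewrite prednK.
have rE : r = expR (- (a * x)) by rewrite -lnr lnK.
pose z := expR (- (s * k%:R)).
apply: (@le_trans _ _ (z ^+ 2 / eps ^+ 2)%:E).
  apply: (@u_eps_le_spike _ _ _ _ _ _ eps0 k.-1).
  apply: spike_Theta => //.
  - exact: ltW.
  - exact: expR_ge0.
  - by rewrite -kE /z -expRD subrr expR0.
  - rewrite -kE /z -expRD rE ler_expR /s.
    have := ler_wpM2l (ltW a0') kx; lra.
rewrite lee_fin ler_pM2r ?invr_gt0 ?exprn_gt0//.
rewrite ler_pXn2r ?nnegrE ?mulr_ge0 ?expR_ge0 ?powR_ge0//.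
rewrite /powR gt_eqF// -expRD ler_expR lnr.
have -> : s / a * - (a * x) = - (s * x) by field; rewrite gt_eqF.
have := s2B; have s0' := s0; have := ler_wpM2l (ltW s0') (ltW xk).
rewrite -natr1; lra.
Qed.

(** Eliminates the radius: a large [u_eps] forces a large [r] by [u_eps_upper], and a large [r]
    forces a large coordinate. The member [eta] itself supplies the condition on [r], through
    [Theta_radius_le]. *)
Lemma Theta_coord_ge (eps r w : R) eta : 0 < eps -> 0 < r ->
  Theta (exp_ellipsoids R) kappa r eta ->
  (w%:E <= u_eps (exp_ellipsoids R) eps kappa r)%E ->
  exists n, peak_const * expR (- (2 * B)) * (eps * Num.sqrt w) <= `|eta n|.
Proof.
move=> eps0 r0 T wu.
have [n nle] := Theta_large_coord r0 T; exists n; apply: le_trans nle.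
rewrite -mulrA ler_wpM2l ?(ltW peak_const_gt0)//.
have ra : 0 < r <= expR (- a) by rewrite r0/=; apply: Theta_radius_le T.
have := le_trans wu (u_eps_upper eps0 ra).
rewrite lee_fin ler_pdivlMr ?exprn_gt0// => wle.
rewrite expRN mulrC ler_pdivrMr ?expR_gt0// [leRHS]mulrC.
have [w0|w0] := leP w 0.
  by rewrite ler0_sqrtr// mulr0 mulr_ge0 ?expR_ge0 ?powR_ge0.
rewrite -(@ler_pXn2r _ 2) ?nnegrE ?mulr_ge0 ?sqrtr_ge0 ?(ltW eps0) ?expR_ge0 ?powR_ge0//.
by rewrite [leLHS]exprMn sqr_sqrtr ?(ltW w0)// [leLHS]mulrC.
Qed.

Lemma u_eps_lower (eps r : R) : 0 < eps -> 0 < r ->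
  (((peak_const * r `^ (s / a)) ^+ 2 / (2 * eps ^+ 2))%:E <=
   u_eps (exp_ellipsoids R) eps kappa r)%E.
Proof.
move=> eps0 r0; apply: u_eps_ge_coord => //.
  by rewrite mulr_ge0 ?powR_ge0// ltW// peak_const_gt0.
by move=> eta; exact: Theta_large_coord.
Qed.

(** A nearly minimal [eta] has only small coordinates, yet by [Theta_large_coord] one of them is at
    least of order r^(s/a). This bounds [r] by the norm of a boundary spike of height [z]. *)
Lemma radius_le_of_u_eps (eps r w w' z : R) : 0 < eps -> 0 < r -> w < w' -> 0 <= z ->
  eps * Num.sqrt (2 * w') <= peak_const * z ->
  (u_eps (exp_ellipsoids R) eps kappa r <= w%:E)%E ->
  r <= z `^ (a / s).
Proof.
move=> eps0 r0 ww' z0 wz uw.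
have [eta T etaw] := u_eps_le_Theta eps0 ww' uw.
have [n nle] := Theta_large_coord r0 T.
apply: powR_rate_inv => //.
rewrite -(ler_pM2l peak_const_gt0) (le_trans nle)// (le_trans (etaw n))//.
Qed.

End uniform_bounds.

Lemma compact_bounded_params (R : realType) (Sigma : set (R * R * R)) :
  compact Sigma ->
  (forall kappa, Sigma kappa ->
     [/\ 0 < alpha_of kappa, 0 < beta_of kappa & 0 < q_of kappa <= 2]) ->
  exists del B : R, [/\ 0 < del, del <= B &
    forall kappa, Sigma kappa -> bounded_params del B kappa].
Proof.
move=> cS Spos.
have [S0|/set0P S0] := eqVneq Sigma set0.
  by exists 1, 1; split => //; rewrite S0.
have ca : {within Sigma, continuous (@alpha_of R)}.
  by apply: continuous_subspaceT => k; apply: cvg_comp; [exact: cvg_fst|exact: cvg_fst].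
have cb : {within Sigma, continuous (@beta_of R)}.
  by apply: continuous_subspaceT => k; apply: cvg_comp; [exact: cvg_fst|exact: cvg_snd].
have [ka1 /set_mem ka1S ha1] := compact_EVT_min S0 cS ca.
have [ka2 /set_mem ka2S ha2] := compact_EVT_max S0 cS ca.
have [kb1 /set_mem kb1S hb1] := compact_EVT_min S0 cS cb.
have [kb2 /set_mem kb2S hb2] := compact_EVT_max S0 cS cb.
exists (Num.min (alpha_of ka1) (beta_of kb1)), (Num.max (alpha_of ka2) (beta_of kb2)).
split.
- by rewrite lt_min; have [-> _ _] := Spos _ ka1S; have [_ -> _] := Spos _ kb1S.
- by rewrite ge_min le_max ha2 ?mem_set.
- move=> k kS; have [_ _ q02] := Spos _ kS; split => //.
    by rewrite ge_min ha1 ?mem_set//= le_max ha2 ?mem_set.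
  by rewrite ge_min hb1 ?mem_set// orbT/= le_max hb2 ?mem_set// orbT.
Qed.

(** * Errors of tests *)

Lemma ge0_mean_le_measure d (T : measurableType d) (R : realType)
    (P : probability T R) (f : T -> R) (u c : R) (A : set T) :
  ge0_mean P f u -> measurable A -> (forall w, f w <= \1_A w) ->
  (P A <= c%:E)%E -> u <= c.
Proof.
move=> [mf f0 fu] mA fA PA; rewrite -lee_fin -fu; apply: le_trans PA.
rewrite -[A in leRHS]setIT -integral_indic//.
apply: ge0_le_integral => //; try exact/measurable_EFinP.
- by move=> w _; rewrite lee_fin f0.
- by move=> w _; rewrite lee_fin fA.
Qed.

Section errors.
Context (R : realType) (d : measure_display) (Omega : measurableType d)
  (P : probability Omega R) (xi : nat -> {RV P >-> R}).

Lemma mean_test_01 eps eta psi : is_test psi -> 0 <= mean xi eps eta psi <= 1.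
Proof. by move=> [mpsi psi01]; exact: mean_01. Qed.

Lemma is_test_compl (psi : (nat -> R) -> R) :
  is_test psi -> is_test (fun y => 1 - psi y).
Proof.
move=> [mpsi psi01]; split; first exact: measurable_funB.
by move=> y; have := psi01 y; lra.
Qed.

Lemma type2_error_ge eps (Th : set (nat -> R)) psi eta : is_test psi -> Th eta ->
  mean xi eps eta (fun y => 1 - psi y) <= type2_error xi eps Th psi.
Proof.
move=> /is_test_compl tpsi Teta; apply: ub_le_sup; last by exists eta.
by exists 1 => _ [e _ <-]; have /andP[] := mean_test_01 eps e tpsi.
Qed.

(** The condition [0 <= c] covers the empty alternative, whose supremum is 0. *)
Lemma type2_error_le eps (Th : set (nat -> R)) psi (c : R) : 0 <= c ->
  (forall eta, Th eta -> mean xi eps eta (fun y => 1 - psi y) <= c) ->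
  type2_error xi eps Th psi <= c.
Proof.
move=> c0 Thc; rewrite /type2_error.
have [->|/set0P[x Ex]] := eqVneq
    [set mean xi eps eta (fun y => 1 - psi y) | eta in Th] set0.
  by rewrite sup0.
by apply: ge_sup; [exists x|move=> _ [eta Te <-]; exact: Thc].
Qed.

Lemma type2_error_01 eps (Th : set (nat -> R)) psi : is_test psi ->
  0 <= type2_error xi eps Th psi <= 1.
Proof.
move=> tpsi; apply/andP; split; last first.
  apply: type2_error_le => // eta _.
  by have /andP[] := mean_test_01 eps eta (is_test_compl tpsi).
have [T0|/set0P[eta Te]] := eqVneq Th set0.
  by rewrite /type2_error T0 image_set0 sup0.
apply: le_trans (type2_error_ge eps tpsi Te).
by have /andP[] := mean_test_01 eps eta (is_test_compl tpsi).
Qed.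

Lemma is_test0 : is_test (fun _ : nat -> R => 0).
Proof. by split => // y; rewrite lexx ler01. Qed.

Lemma minimax_error_le eps (Th : set (nat -> R)) psi : is_test psi ->
  minimax_error xi eps Th <= type1_error xi eps psi + type2_error xi eps Th psi.
Proof.
move=> tpsi; apply: ge_inf; last by exists psi.
exists 0 => _ [p tp <-]; rewrite addr_ge0//.
  by have /andP[] := mean_test_01 eps (fun=> 0) tp.
by have /andP[] := type2_error_01 eps Th tp.
Qed.

Lemma minimax_error_ge eps (Th : set (nat -> R)) (c : R) :
  (forall psi, is_test psi ->
     c <= type1_error xi eps psi + type2_error xi eps Th psi) ->
  c <= minimax_error xi eps Th.
Proof.
move=> cle; apply: lb_le_inf; last by move=> _ [psi tpsi <-]; exact: cle.
exists (type1_error xi eps (fun=> 0) + type2_error xi eps Th (fun=> 0)).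
by exists (fun=> 0) => //; exact: is_test0.
Qed.

Lemma minimax_error_le1 eps (Th : set (nat -> R)) : minimax_error xi eps Th <= 1.
Proof.
apply: le_trans (minimax_error_le eps Th is_test0) _.
have /andP[_ h2] := type2_error_01 eps Th is_test0.
rewrite (_ : type1_error _ _ _ = 0) ?add0r//.
by rewrite /type1_error /mean unlock integral0.
Qed.

Lemma measurable_exceed (h : nat -> R) :
  measurable ([set z | exists n, h n < `|z n|] : set (seqspace R)).
Proof.
rewrite (_ : [set z | _] = \bigcup_n ((fun y : seqspace R => y n) @^-1`
    [set x | h n < `|x|])); last first.
  by apply/seteqP; split => z /= [n]; [exists n|move=> _; exists n].
apply: bigcupT_measurable => n; rewrite -[X in measurable X]setTI.
apply: measurable_coord => //.
rewrite -[X in measurable X]setTI.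
rewrite -[X in setT `&` X]/((fun x => `|x|) @^-1` [set y | h n < y]).
apply: (@normr_measurable R setT) => //.
by rewrite -set_itvoy.
Qed.

Lemma threshold_test_is_test (C : R) (L : int) (eps : R) :
  is_test (threshold_test C L eps).
Proof.
split => [|y].
  apply: measurable_indic.
  exact: (@measurable_exceed (fun n => eps * threshold C L n.+1)).
by rewrite /threshold_test indicE; case: (_ \in _); rewrite ?lexx ler01.
Qed.

Hypothesis iid_xi : iid_standard_normal xi.

Lemma measurable_normal_tail (t : R) (n : nat) :
  measurable [set w | t <= `|xi n w|].
Proof.
rewrite -[X in measurable X]setTI.
rewrite -[X in setT `&` X]/((fun w => `|xi n w|) @^-1` [set y | t <= y]).
have mn : measurable_fun setT (fun w => `|xi n w|).
  exact: measurableT_comp.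
apply: mn => //; by rewrite -set_itvcy.
Qed.

Lemma noise_tail (t : R) (n : nat) : 0 < t ->
  (P [set w | (t <= `|xi n w|)%R] <= (2 * (expR (- (t ^+ 2 / 2)) / t))%:E)%E.
Proof.
move=> t0; apply: le_trans (normal_prob_tail t0).
have [_ dist] := iid_xi; rewrite -(dist n)//.
rewrite -[X in measurable X]setTI.
rewrite -[X in setT `&` X]/((fun x : R => `|x|) @^-1` [set y | t <= y]).
by apply: (@normr_measurable R setT) => //; rewrite -set_itvcy.
Qed.

(** Unless the noise at coordinate [n] reaches [T], that coordinate alone triggers the test. The
    exponential factor of the noise tail is dropped, since [T] will tend to infinity. *)
Lemma type2_coord (C : R) (L : int) (eps T : R) (eta : nat -> R) (n : nat) :
  0 < eps -> 0 < T -> eps * (threshold C L n.+1 + T) <= `|eta n| ->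
  mean xi eps eta (fun y => 1 - threshold_test C L eps y) <= 2 / T.
Proof.
move=> eps0 T0 etaT.
have [mpsi psi01] := is_test_compl (threshold_test_is_test C L eps).
have M := mean_ge0_mean xi eps eta mpsi psi01.
apply: (ge0_mean_le_measure M (measurable_normal_tail T n)) => [w|]; last first.
  apply: (le_trans (noise_tail n T0)); rewrite lee_fin mulrA.
  rewrite ler_pM2r ?invr_gt0// -[leRHS]mulr1 ler_pM2l// -expR0 ler_expR.
  by rewrite oppr_le0 divr_ge0 ?sqr_ge0.
rewrite /threshold_test !indicE.
have [/set_mem/= Tw|/negP Tw] := boolP (w \in [set w | T <= `|xi n w|]).
  by case: (_ \in _); rewrite ?subrr ?subr0.
rewrite mem_set ?subrr//=.
exists n; rewrite /observation.
have {}Tw : `|xi n w| < T.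
  by rewrite ltNge; apply/negP => h; apply: Tw; rewrite inE.
have := ler_distD 0 (eta n + eps * xi n w) (eps * xi n w).
rewrite addrK subr0 sub0r normrN [X in _ <= _ + X]normrM (gtr0_norm eps0).
have : eps * `|xi n w| < eps * T by rewrite ltr_pM2l.
move: etaT; rewrite mulrDr; lra.
Qed.

End errors.

(** * First-kind error of the threshold test *)

Lemma sum_initial_le (R : realType) (c : R) (m N : nat) : 0 <= c ->
  \sum_(0 <= n < N) (if (n.+1 < m)%N then c else 0) <= c * m%:R.
Proof.
move=> c0; apply: (@le_trans _ _ (c * (minn N m)%:R)); last first.
  by rewrite ler_wpM2l// ler_nat geq_minr.
elim: N => [|N IHN]; first by rewrite big_geq// min0n mulr0.
rewrite big_nat_recr//=; apply: (le_trans (lerD IHN (lexx _))).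
case: (boolP (N.+1 < m)%N) => Nm.
  by rewrite (minn_idPl (ltnW (ltnW Nm))) (minn_idPl (ltnW Nm)) -natr1 mulrDr mulr1.
by rewrite addr0 ler_wpM2l// ler_nat leq_min geq_minr (leq_trans (geq_minl _ _)).
Qed.

(* The terms are dominated by the increments of [- k ^ (1 - p) / (p - 1)]. *)
Lemma sum_tail_le (R : realType) (p : R) (m N : nat) : 1 < p -> (1 < m)%N ->
  \sum_(0 <= n < N) (if (n.+1 < m)%N then 0 else expR (- (p * ln n.+1%:R))) <=
  expR (- ((p - 1) * ln m.-1%:R)) / (p - 1).
Proof.
move=> p1 m1; pose g (k : nat) : R := expR (- ((p - 1) * ln k%:R)).
have p10 : 0 < p - 1 by rewrite subr_gt0.
have step (k : nat) : (0 < k)%N ->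
    expR (- (p * ln k.+1%:R)) <= (g k - g k.+1) / (p - 1).
  move=> k0; have k0' : 0 < k%:R :> R by rewrite ltr0n.
  (* This is ln(1 + u) <= u at u = -1/(k+1). *)
  have lnk : k.+1%:R^-1 <= ln k.+1%:R - ln k%:R :> R.
    have := @le_ln1Dx R (- k.+1%:R^-1).
    rewrite ltrN2 invf_lt1 ?ltr0n// ltr1n ltnS => /(_ k0).
    rewrite (_ : 1 + - k.+1%:R^-1 = k%:R / k.+1%:R); last first.
      by rewrite -natr1; field; rewrite natr1 pnatr_eq0.
    by rewrite ln_div ?posrE ?ltr0n// lerNr opprB.
  rewrite ler_pdivlMr// /g.
  have -> : - (p * ln k.+1%:R) = - ((p - 1) * ln k.+1%:R) - ln k.+1%:R by ring.
  have -> : - ((p - 1) * ln k%:R) = - ((p - 1) * ln k.+1%:R) +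
    (p - 1) * (ln k.+1%:R - ln k%:R) :> R by ring.
  rewrite expRB expRD lnK ?posrE ?ltr0n//.
  set G := expR (- _); have G0 : 0 < G by exact: expR_gt0.
  have := expR_ge1Dx ((p - 1) * (ln k.+1%:R - ln k%:R)).
  have := ler_wpM2l (ltW p10) lnk.
  set E := expR _ => h1 h2.
  rewrite -mulrA -[X in _ <= _ - X]mulr1 -mulrBr ler_wpM2l ?(ltW G0)//.
  rewrite mulrC; apply: le_trans h1 _.
  by rewrite lerBrDl.
(* Nonzero terms start at [n = m.-1], that is, at coordinate [m]; from there the increments of [g]
   telescope. *)
pose H N := if (N < m.-1)%N then 0 else (g m.-1 - g N) / (p - 1).
apply: (@le_trans _ _ (H N)); last first.
  rewrite /H; case: ifP => _; first by rewrite divr_ge0 ?expR_ge0 ?ltW.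
  by rewrite ler_pM2r ?invr_gt0// gerBl expR_ge0.
have mE : m = m.-1.+1 by rewrite prednK// (ltn_trans _ m1).
have m0 : (0 < m.-1)%N by rewrite -ltnS -mE.
elim: N => [|N IHN]; first by rewrite big_geq// /H m0.
rewrite big_nat_recr//=; apply: le_trans (lerD IHN (lexx _)) _.
have -> : (N.+1 < m)%N = (N < m.-1)%N by rewrite {1}mE ltnS.
rewrite /H; case: (ltnP N m.-1) => Nm.
  rewrite addr0; case: ltnP => // Nm'.
  have -> : N.+1 = m.-1 by apply/eqP; rewrite eqn_leq Nm Nm'.
  by rewrite subrr mul0r.
rewrite ifF; last by apply/negbTE; rewrite -leqNgt (leq_trans Nm).
have := step N (leq_trans m0 Nm); rewrite !mulrBl; lra.
Qed.

Section type1.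
Context (R : realType) (d : measure_display) (Omega : measurableType d)
  (P : probability Omega R) (xi : nat -> {RV P >-> R}).
Hypothesis iid_xi : iid_standard_normal xi.

(** Union bound. Each coordinate below L exceeds its threshold with probability at most 2/(L sqrt(2
    log L)), for a total of at most 2/B. The others contribute the tail of a convergent series with
    exponent C/2 > 1. The hypothesis on [L] gives log(L - 1) >= B^2, where [B] measures how far [L]
    has grown. *)
Lemma type1_le (C : R) (L : int) (eps B : R) : 0 < eps -> 2 < C -> 1 <= B ->
  expR (B ^+ 2) + 1 <= L%:~R ->
  type1_error xi eps (threshold_test C L eps) <=
  (2 + 2 / (C / 2 - 1) ^+ 2) / B.
Proof.
move=> eps0 C2 B1 BL.
have B0 : 0 < B by exact: lt_le_trans B1.
have eB : 1 <= expR (B ^+ 2) by rewrite -[leLHS]expR0 ler_expR sqr_ge0.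
case: L BL => [m|m] BL; last first.
  have : (Negz m)%:~R <= 0 :> R by rewrite lerz0.
  by lra.
rewrite -pmulrn in BL.
have m1 : (1 < m)%N by rewrite -(ltr_nat R); lra.
have m0 : (0 < m.-1)%N by rewrite -subn1 subn_gt0.
have lnm1 : B ^+ 2 <= ln m.-1%:R.
  rewrite -[leLHS]expRK ler_ln ?posrE ?expR_gt0 ?ltr0n//.
  by rewrite -subn1 natrB ?(ltnW m1)//; lra.
have lnm : ln m.-1%:R <= ln m%:R :> R.
  by rewrite ler_ln ?posrE ?ltr0n ?(ltn_trans _ m1)// ler_nat leq_pred.
have B2 : B <= B ^+ 2 by rewrite expr2 ler_peMl// ltW.
have lnB : B ^+ 2 <= ln m%:R := le_trans lnm1 lnm.
have lnB1 : B <= ln m%:R := le_trans B2 lnB.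
have lnm0 : 0 < ln m%:R :> R := lt_le_trans B0 lnB1.
pose c1 := 2 / (m%:R * B).
have c10 : 0 <= c1 by rewrite divr_ge0 ?mulr_ge0 ?ler0n ?(ltW B0).
pose v n : R := (if (n.+1 < m)%N then c1 else 0) +
  2 * (if (n.+1 < m)%N then 0 else expR (- (C / 2 * ln n.+1%:R))).
pose h n := threshold C (Posz m) n.+1.
have h0v n : 0 < h n /\ 2 * (expR (- (h n ^+ 2 / 2)) / h n) <= v n.
  rewrite /h /threshold /v ltz_nat; case: ltnP => nm.
    have l0 : 0 < 2 * ln m%:R :> R by rewrite mulr_gt0.
    split; first by rewrite sqrtr_gt0.
    rewrite mulr0 addr0 sqr_sqrtr ?(ltW l0)//.
    have -> : 2 * ln m%:R / 2 = ln m%:R :> R by field.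
    rewrite expRN lnK ?posrE ?ltr0n ?(ltn_trans _ m1)// /c1 invfM.
    rewrite ler_pM2l// ler_pM2l ?invr_gt0 ?ltr0n ?(ltn_trans _ m1)//.
    rewrite lef_pV2 ?posrE ?sqrtr_gt0//.
    rewrite -[leLHS]ger0_norm ?(ltW B0)// -sqrtr_sqr ler_sqrt ?(ltW l0)//; lra.
  have lnn : ln m%:R <= ln n.+1%:R :> R.
    by rewrite ler_ln ?posrE ?ltr0n ?(ltn_trans _ m1)// ler_nat.
  have l1 : 1 <= C * ln n.+1%:R by nra.
  have s1 : 1 <= Num.sqrt (C * ln n.+1%:R) by rewrite -[leLHS]sqrtr1 ler_sqrt//; lra.
  split; first by lra.
  rewrite add0r sqr_sqrtr; last lra.
  have -> : C * ln n.+1%:R / 2 = C / 2 * ln n.+1%:R by field.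
  by rewrite ler_pM2l// ler_pdivrMr ?(lt_le_trans ltr01 s1)// ler_peMr// expR_ge0.
pose A n := [set w | h n <= `|xi n w|].
have mA n : measurable (A n) by exact: measurable_normal_tail.
have [mpsi psi01] := threshold_test_is_test C (Posz m) eps.
have M := mean_ge0_mean xi eps (fun=> 0) mpsi psi01.
apply: (ge0_mean_le_measure M (A := \bigcup_n A n)).
- exact: bigcupT_measurable.
- move=> w; rewrite /threshold_test !indicE.
  have [/set_mem/= [n wn]|_] := boolP (observation _ _ _ _ \in _); last by rewrite ler0n.
  rewrite mem_set//=; exists n => //; rewrite /A/=.
  move: wn; rewrite /observation add0r normrM gtr0_norm// ltr_pM2l//.
  exact: ltW.
- apply: (@le_trans _ _ (\sum_(0 <= n <oo) P (A n))%E).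
    by apply: measure_sigma_subadditive => //; exact: bigcupT_measurable.
  apply: (@le_trans _ _ (\sum_(0 <= n <oo) (v n)%:E)%E).
    apply: lee_nneseries => // n _; have [hn0 hv] := h0v n.
    by apply: (le_trans (noise_tail iid_xi n hn0)); rewrite lee_fin.
  apply: nneseries_le_fin => [n|N].
    have [hn0 hv] := h0v n; apply: le_trans hv.
    by rewrite mulr_ge0// divr_ge0 ?expR_ge0 ?ltW.
  rewrite big_split/= -big_distrr/=.
  apply: (le_trans (lerD (sum_initial_le m N c10)
    (ler_wpM2l _ (sum_tail_le N _ m1)))) => //.
    lra.
  set q := C / 2 - 1; have q0 : 0 < q by rewrite /q; lra.
  have mB : c1 * m%:R = 2 / B.
    by rewrite /c1; field; rewrite gt_eqF//= pnatr_eq0 -lt0n (ltn_trans _ m1).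
  have : expR (- (q * ln m.-1%:R)) <= (q * B)^-1.
    rewrite expRN lef_pV2 ?posrE ?expR_gt0 ?mulr_gt0//.
    have := expR_ge1Dx (q * ln m.-1%:R).
    have : q * B <= q * ln m.-1%:R by rewrite ler_pM2l//; lra.
    lra.
  move=> ele; rewrite mB [leRHS]mulrDl lerD2l.
  have -> : 2 / q ^+ 2 / B = 2 * ((q * B)^-1 / q) by field; rewrite !gt_eqF.
  by rewrite ler_pM2l// ler_pM2r ?invr_gt0.
Qed.

End type1.

(** * Asymptotics *)

(** Lets every estimate for small eps be made in terms of t = loglog(1/eps), with 1/eps =
    exp(exp(t)) and t as large as desired. *)
Lemma near_loglog (R : realType) (A : R) :
  \forall eps \near 0^'+, [/\ 0 < eps, eps = expR (- expR (loglog eps)) &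
    A <= loglog eps].
Proof.
near=> eps.
have e0 : 0 < eps by near: eps; exact: nbhs_right_gt.
have eA : eps < expR (- expR A).
  by near: eps; apply: nbhs_right_lt; exact: expR_gt0.
have lnA : expR A < ln eps^-1.
  by rewrite lnV ?posrE// ltrNr -[ltRHS]expRK ltr_ln ?posrE ?expR_gt0.
have ln0 : 0 < ln eps^-1 by apply: lt_trans lnA; exact: expR_gt0.
split => //.
  by rewrite /loglog lnK ?posrE// lnV ?posrE// opprK lnK ?posrE.
by rewrite /loglog -[leLHS]expRK ler_ln ?posrE ?expR_gt0// ltW.
Unshelve. all: by end_near. Qed.

Section limits_of_ratios.
Context (R : realType) (K : Type) (F : ellipsoids R K) (Sigma : set K)
  (r : R -> K -> R).

(** A non-strict bound on the limsup only gives eventual bounds by larger constants, hence [c']; for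
    the liminf the strict hypothesis already contains this margin. *)
Lemma limsup_sup_ratio_near (c c' : R) : c < c' ->
  (limsup_sup_ratio F Sigma r (@loglog R) <= c%:E)%E ->
  \forall eps \near 0^'+, forall kappa, Sigma kappa ->
    (u_eps F eps kappa (r eps kappa) <= (c' * loglog eps)%:E)%E.
Proof.
move=> cc'; rewrite /limsup_sup_ratio limf_esupE => H.
have /ereal_inf_lt[_ [V V0 <-] supV] : (ereal_inf [set ereal_sup ((fun eps : R =>
    ereal_sup [set (u_eps F eps kappa (r eps kappa) * ((loglog eps)^-1)%:E)%E |
               kappa in Sigma]) @` W) | W in (0 : R)^'+] < c'%:E)%E.
  by apply: le_lt_trans H _; rewrite lte_fin.
near=> eps => kappa kS.
have Ve : V eps by near: eps.
have [e0 _ t1] : [/\ 0 < eps, eps = expR (- expR (loglog eps)) & 1 <= loglog eps].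
  by near: eps; exact: near_loglog.
have t0 : 0 < loglog eps by lra.
have : (u_eps F eps kappa (r eps kappa) * ((loglog eps)^-1)%:E <= c'%:E)%E.
  apply: le_trans (ltW supV).
  apply: le_trans (ereal_sup_ubound _); last by exists eps.
  by apply: ereal_sup_ubound; exists kappa.
by rewrite lee_pdivrMr// muleC -EFinM mulrC.
Unshelve. all: by end_near. Qed.

Lemma liminf_inf_ratio_near (c : R) :
  (c%:E < liminf_inf_ratio F Sigma r (@loglog R))%E ->
  \forall eps \near 0^'+, forall kappa, Sigma kappa ->
    ((c * loglog eps)%:E <= u_eps F eps kappa (r eps kappa))%E.
Proof.
rewrite /liminf_inf_ratio limf_einfE => /ereal_sup_gt[_ [V V0 <-] infV].
near=> eps => kappa kS.
have Ve : V eps by near: eps.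
have [e0 _ t1] : [/\ 0 < eps, eps = expR (- expR (loglog eps)) & 1 <= loglog eps].
  by near: eps; exact: near_loglog.
have t0 : 0 < loglog eps by lra.
have : (c%:E <= u_eps F eps kappa (r eps kappa) * ((loglog eps)^-1)%:E)%E.
  apply: le_trans (ltW infV) _.
  apply: le_trans (ereal_inf_lbound _) _; first by exists eps.
  by apply: ereal_inf_lbound; exists kappa.
by rewrite lee_pdivlMr// -EFinM.
Unshelve. all: by end_near. Qed.

End limits_of_ratios.

(** Both branches are at most sqrt(2 C t): the first because ln L <= L - 1 <= t, the second by the
    bound on ln k. This is where L = o(loglog(1/eps)) enters. *)
Lemma threshold_le (R : realType) (C t : R) (L : int) (k : nat) :
  2 < C -> 1 <= t -> 1 <= (L%:~R : R) <= t -> ln k%:R <= 2 * t ->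
  threshold C L k <= Num.sqrt (2 * C) * Num.sqrt t.
Proof.
move=> C2 t1 /andP[L1 Lt] lnk.
rewrite -sqrtrM; last lra.
have lnL : ln L%:~R <= t.
  have := @le_ln1Dx R (L%:~R - 1).
  by rewrite subrKC; lra.
rewrite /threshold; case: ifP => _; rewrite ler_wsqrtr//; nra.
Qed.

(** * Error bounds at a fixed noise level *)

Section main.
Context (R : realType) (d : measure_display) (Omega : measurableType d)
  (P : probability Omega R) (xi : nat -> {RV P >-> R}).
Hypothesis iid_xi : iid_standard_normal xi.
Context (del B : R).
Hypothesis del0 : 0 < del.
Local Notation F := (exp_ellipsoids R).

(* With this constant, the coordinate found by [Theta_coord_ge] exceeds the
   bound [threshold_le] on the threshold by [eps * sqrt (loglog eps)]. *)
Definition detection_const (C : R) : R :=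
  ((Num.sqrt (2 * C) + 1) / (peak_const del B * expR (- (2 * B)))) ^+ 2.

Lemma type2_le (C : R) (L : int) (eps r : R) (kappa : R * R * R) eta :
  let t := loglog eps in
  bounded_params del B kappa -> 2 < C -> 0 < eps -> eps = expR (- expR t) ->
  1 <= t -> - ln (2 * del) <= t -> 1 <= (L%:~R : R) <= t -> 0 < r ->
  Theta F kappa r eta ->
  ((detection_const C * t)%:E <= u_eps F eps kappa r)%E ->
  mean xi eps eta (fun y => 1 - threshold_test C L eps y) <= 2 / Num.sqrt t.
Proof.
move=> t adm C2 eps0 epsE t1 tdel Lt r0 T uD.
have d0 := del0.
set c1 := peak_const del B * expR (- (2 * B)).
have c10 : 0 < c1 by rewrite mulr_gt0 ?expR_gt0// peak_const_gt0.
have C0 : 0 <= Num.sqrt (2 * C) by exact: sqrtr_ge0.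
have st1 : 1 <= Num.sqrt t by rewrite -[leLHS]sqrtr1 ler_wsqrtr.
have [n nge] := Theta_coord_ge del0 adm eps0 r0 T uD.
have {}nge : eps * ((Num.sqrt (2 * C) + 1) * Num.sqrt t) <= `|eta n|.
  apply: le_trans nge; rewrite -/c1 /detection_const -/c1.
  set Q := Num.sqrt (2 * C) in C0 *.
  rewrite [Num.sqrt (_ * t)]sqrtrM ?sqr_ge0// sqrtr_sqr.
  rewrite ger0_norm ?divr_ge0 ?addr_ge0 ?(ltW c10)//.
  rewrite le_eqVlt; apply/orP; left; apply/eqP.
  by field; rewrite gt_eqF.
apply: (@type2_coord _ _ _ _ xi iid_xi C L eps (Num.sqrt t) eta n) => //.
  by lra.
apply: (le_trans _ nge); rewrite ler_pM2l// mulrDl mul1r lerD2r.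
apply: threshold_le => //.
have [/andP[da _] /andP[db _] q02] := adm.
set s := alpha_of kappa + beta_of kappa.
(* A coordinate of size at least eps has index of order at most log(1/eps), because the ellipsoid
   forces exponential decay. This gives ln(n+1) <= t - ln(2 del) <= 2t for the threshold bound. *)
have : eps <= expR (- (s * n.+1%:R)).
  apply: le_trans (Theta_coord_le q02 n T).
  apply: le_trans nge; rewrite -[leLHS]mulr1 ler_pM2l//.
  by rewrite -[leLHS]mulr1 ler_pM//; lra.
rewrite epsE ler_expR lerN2 => sn.
have n0 : 0 < n.+1%:R :> R by rewrite ltr0n.
have {}sn : 2 * del * n.+1%:R <= expR t.
  by apply: le_trans sn; rewrite ler_pM2r// /s; lra.
have : ln (2 * del * n.+1%:R) <= t.
  by rewrite -[leRHS]expRK ler_ln ?posrE ?expR_gt0// !mulr_gt0.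
by rewrite lnM ?posrE ?mulr_gt0//; lra.
Qed.

Lemma minimax_ge (eps lam p1 p2 : R) (Sigma : set (R * R * R))
    (r : R * R * R -> R) :
  let t := loglog eps in
  (forall kappa, Sigma kappa -> bounded_params del B kappa) ->
  (forall kappa, Sigma kappa -> 0 < r kappa) ->
  0 < p1 -> p1 < p2 ->
  [set x | p1 <= x <= p2] `<=` [set phi kappa | kappa in Sigma] ->
  0 < eps -> eps = expR (- expR t) -> 0 < lam ->
  2 <= t -> 2 <= (p2 - p1) * t -> 4 <= (p2 - p1) * t * lam ^+ 2 ->
  (forall kappa, Sigma kappa ->
     (u_eps F eps kappa (r kappa) <= (peak_const del B ^+ 2 / 8 * t)%:E)%E) ->
  1 - lam <= minimax_error xi eps (Theta_adaptive F Sigma r).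
Proof.
move=> t adm r0 p10 p12 phiS eps0 epsE lam0 t2 t2p t4p uS.
have d0 := del0.
have c0 : 0 < peak_const del B by exact: peak_const_gt0.
have c20 : 0 < peak_const del B ^+ 2 by rewrite exprn_gt0.
have e2 : t / 2 <= expR (t / 2) by have := expR_ge1Dx (t / 2); lra.
have et : t <= expR t by have := expR_ge1Dx t; lra.
pose b := Num.sqrt (t / 2); pose z := eps * b.
have b1 : 1 <= b by rewrite -[leLHS]sqrtr1 ler_wsqrtr//; lra.
have b2 : b ^+ 2 = t / 2 by rewrite sqr_sqrtr//; lra.
have z0 : 0 < z by rewrite mulr_gt0//; lra.
pose l := - ln z.
have zE : z = expR (- l) by rewrite opprK lnK.
(* [expR t] is log(1/eps), so replacing eps by the spike height loses at most half of the
   logarithm. *)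
have lE : expR t / 2 <= l.
  rewrite /l /z lnM ?posrE//; last lra.
  rewrite {1}epsE expRK.
  have := @le_ln1Dx R (b - 1); rewrite subrKC => H.
  have : ln b <= b - 1 by apply: H; lra.
  have : b <= b ^+ 2 by rewrite expr2 ler_peMl//; lra.
  by rewrite b2; lra.
have l0 : 0 < l by have := expR_gt0 t; lra.
(* The constants are tuned for this: with w' = peak_const^2 t / 4, the coordinate bound eps sqrt(2
   w') equals [peak_const * z]. *)
have rz kappa : Sigma kappa ->
    r kappa <= z `^ (alpha_of kappa / (alpha_of kappa + beta_of kappa)).
  move=> kS; apply: (radius_le_of_u_eps del0 (adm _ kS) eps0 (r0 _ kS) _
    (ltW z0) _ (uS _ kS) (w' := peak_const del B ^+ 2 / 4 * t)); first by nra.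
  have -> : 2 * (peak_const del B ^+ 2 / 4 * t) =
    peak_const del B ^+ 2 * (t / 2) by field.
  rewrite sqrtrM ?(ltW c20)// sqrtr_sqr gtr0_norm// -/b /z.
  by rewrite mulrCA.
(* The coordinates m = m0 + 1, ..., m0 + N all satisfy p1 <= m/(2l) <= p2. *)
pose m0 := Num.truncn (2 * p1 * l); pose N := Num.truncn (2 * (p2 - p1) * l).
have p210 : 0 < p2 - p1 by lra.
have m0b := truncn_itv (ltW (mulr_gt0 (mulr_gt0 (ltr0Sn R 1) p10) l0)).
have Nb := truncn_itv (ltW (mulr_gt0 (mulr_gt0 (ltr0Sn R 1) p210) l0)).
rewrite -/m0 -/N -!natr1 in m0b Nb.
have /andP[m0l m0u] := m0b; have /andP[Nl Nu] := Nb.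
have Nge : (p2 - p1) * expR t / 2 <= N%:R.
  have h1 := ler_wpM2l (ltW p210) lE.
  have h2 := ler_wpM2l (ltW p210) et.
  by lra.
have N0' : 0 < N%:R :> R.
  by apply: lt_le_trans Nge; rewrite divr_gt0// mulr_gt0// expR_gt0.
have N0 : (0 < N)%N by rewrite -(ltr_nat R).
have V : (expR (b ^+ 2) - 1) / N%:R <= lam ^+ 2.
  rewrite ler_pdivrMr// b2.
  have l20 : 0 <= lam ^+ 2 by exact: sqr_ge0.
  apply: (@le_trans _ _ (lam ^+ 2 * ((p2 - p1) * expR t / 2))); last first.
    by rewrite ler_wpM2l.
  have -> : expR t = expR (t / 2) * expR (t / 2) by rewrite -expRD; congr expR; field.
  set E := expR (t / 2) in e2 *; have E0 : 0 < E by exact: expR_gt0.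
  have h : 1 <= lam ^+ 2 * (p2 - p1) * E / 2.
    have : lam ^+ 2 * (p2 - p1) * (t / 2) <= lam ^+ 2 * (p2 - p1) * E.
      by rewrite ler_wpM2l// mulr_ge0// ltW.
    by lra.
  have := ler_wpM2r (ltW E0) h; lra.
have inTheta (i : 'I_N) : Theta_adaptive F Sigma r (spike (m0 + i) z).
  pose m := (m0 + i).+1.
  have mR : m%:R = m0%:R + i%:R + 1 :> R by rewrite /m -natr1 natrD.
  have iN : i%:R + 1 <= N%:R :> R by rewrite natr1 ler_nat.
  have i0 : 0 <= i%:R :> R by rewrite ler0n.
  have mpos : 0 < m%:R :> R by rewrite ltr0n.
  (* Choose kappa for each coordinate separately so that (alpha + beta) m = l. The spike of height z
     = exp(-l) is then exactly on the boundary of its ellipsoid, and its norm exp(-alpha m) is the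
     bound [rz] on the radius. *)
  have [|kappa kS phik] := phiS (m%:R / (2 * l)).
    rewrite /= ler_pdivlMr ?mulr_gt0// ler_pdivrMr ?mulr_gt0// mR.
    by apply/andP; split; lra.
  exists kappa => //.
  have [/andP[da _] /andP[db _] q02] := adm _ kS.
  have sE : (alpha_of kappa + beta_of kappa) * m%:R = l.
    move: phik; rewrite /phi; set s := _ + _ => /(congr1 GRing.inv).
    rewrite invrK invf_div => h.
    have -> : s = l / m%:R by move: h; rewrite -mulrA; apply: mulfI; rewrite pnatr_eq0.
    by rewrite divfK// gt_eqF.
  apply: spike_Theta => //.
  - exact/ltW/r0.
  - exact: ltW.
  - by rewrite -/m sE zE -expRD subrr expR0.
  - apply: le_trans (rz _ kS) _; rewrite /powR gt_eqF// {1}zE expRK -/m.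
    rewrite [X in _ <= _ * X]zE -expRD ler_expR -sE.
    rewrite le_eqVlt; apply/orP; left; apply/eqP; field.
    by rewrite gt_eqF//; lra.
apply: minimax_error_ge => psi tpsi.
have := @bayes_risk_ge _ _ _ _ _ iid_xi eps b lam m0 N psi N0 lam0 tpsi.
set A := mean _ _ _ _; set T2 := type2_error _ _ _ _; rewrite -/z => risk.
have avg : N%:R^-1 * \sum_(i < N) mean xi eps (spike (m0 + i) z)
    (fun y => 1 - psi y) <= T2.
  rewrite mulrC ler_pdivrMr// -[X in _ <= _ * X%:R](card_ord N) mulr_natr -sumr_const.
  by apply: ler_sum => i _; apply: type2_error_ge.
have : (expR (b ^+ 2) - 1) / N%:R / (2 * lam) <= lam / 2.
  rewrite ler_pdivrMr ?mulr_gt0//; apply: (le_trans V).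
  by rewrite le_eqVlt; apply/orP; left; apply/eqP; field.
rewrite /type1_error -/A; lra.
Qed.

End main.

(** * Convergence of the errors as eps tends to 0 *)

Lemma loglog_cvg (R : realType) : @loglog R eps @[eps --> 0^'+] --> (+oo : set_system R).
Proof.
apply/cvgryPge => A; apply: filterS (near_loglog A) => eps.
by case.
Qed.

(** Adaptive distinguishability mentions no [L], so a concrete one is needed to use the threshold
    test there. *)
Lemma ex_admissible_L (R : realType) : exists L : R -> int, admissible_L L.
Proof.
exists (fun eps => (Num.truncn (Num.sqrt (loglog eps)))%:Z).
have tr (eps : R) := truncn_itv (sqrtr_ge0 (loglog eps)).
split.
  apply/cvgryPge => A; near=> eps.
  have [_ _] : [/\ 0 < eps, eps = expR (- expR (loglog eps)) &
      (`|A| + 1) ^+ 2 <= loglog eps].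
    by near: eps; exact: near_loglog.
  move=> /ler_wsqrtr; rewrite sqrtr_sqr ger0_norm ?addr_ge0// => At.
  have := tr eps; rewrite -natr1 -pmulrn => /andP[_ h].
  by have := ler_norm A; lra.
apply/cvgrPdist_le => e e0; near=> eps.
have [_ _] : [/\ 0 < eps, eps = expR (- expR (loglog eps)) &
    (e^-1) ^+ 2 + 1 <= loglog eps].
  by near: eps; exact: near_loglog.
have ei := sqr_ge0 e^-1 => et.
have t0 : 0 < loglog eps by lra.
rewrite sub0r normrN -pmulrn ger0_norm ?divr_ge0 ?(ltW t0)//.
have /andP[h _] := tr eps.
rewrite ler_pdivrMr//; apply: (le_trans h).
have st0 : 0 < Num.sqrt (loglog eps) by rewrite sqrtr_gt0.
rewrite -[X in e * X](sqr_sqrtr (ltW t0)) expr2 mulrA ler_peMl ?(ltW st0)//.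
rewrite mulrC -ler_pdivrMr// div1r.
by rewrite -[leLHS]ger0_norm ?invr_ge0 ?(ltW e0)// -sqrtr_sqr ler_wsqrtr//; lra.
Unshelve. all: by end_near. Qed.

Section convergence.
Context (R : realType) (d : measure_display) (Omega : measurableType d)
  (P : probability Omega R) (xi : nat -> {RV P >-> R}).
Hypothesis iid_xi : iid_standard_normal xi.
Local Notation F := (exp_ellipsoids R).

Lemma type1_cvg (C : R) (L : R -> int) : 2 < C -> admissible_L L ->
  type1_error xi eps (threshold_test C (L eps) eps) @[eps --> 0^'+] --> (0 : R).
Proof.
move=> C2 [Loo _]; apply/cvgrPdist_le => e e0.
pose c := 2 + 2 / (C / 2 - 1) ^+ 2.
have c0 : 0 < c by rewrite ltr_pwDl// divr_ge0 ?sqr_ge0.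
pose B := Num.max 1 (c / e).
have B1 : 1 <= B by rewrite le_max lexx.
have ceB : c / e <= B by rewrite le_max lexx orbT.
near=> eps.
have eps0 : 0 < eps by near: eps; exact: nbhs_right_gt.
have BL : expR (B ^+ 2) + 1 <= (L eps)%:~R.
  by near: eps; move/cvgryPge : Loo; exact.
have := type1_le iid_xi eps0 C2 B1 BL; rewrite -/c => le1.
have /andP[ge0 _] := mean_test_01 xi eps (fun=> 0) (threshold_test_is_test C (L eps) eps).
rewrite sub0r normrN ger0_norm//; apply: (le_trans le1).
have B0 : 0 < B by lra.
by rewrite ler_pdivrMr// mulrC -ler_pdivrMr.
Unshelve. all: by end_near. Qed.

Context (Sigma : set (R * R * R)) (del B : R).
Hypotheses (del0 : 0 < del)
  (adm : forall kappa, Sigma kappa -> bounded_params del B kappa).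

Lemma detection_const_gt0 (C : R) : 0 < detection_const del B C.
Proof.
rewrite exprn_gt0// divr_gt0 ?mulr_gt0 ?expR_gt0 ?peak_const_gt0//.
Qed.

Lemma type2_cvg (C : R) (L : R -> int) (r : R -> R * R * R -> R) : 2 < C ->
  admissible_L L -> radii Sigma r ->
  ((detection_const del B C)%:E < liminf_inf_ratio F Sigma r (@loglog R))%E ->
  type2_error xi eps (Theta_adaptive F Sigma (r eps))
    (threshold_test C (L eps) eps) @[eps --> 0^'+] --> (0 : R).
Proof.
move=> C2 [Loo Lt0] rad /liminf_inf_ratio_near uD.
apply/cvgrPdist_le => e e0.
pose T := Num.max (Num.max 1 (- ln (2 * del))) ((2 / e) ^+ 2).
near=> eps.
have [eps0 epsE] : [/\ 0 < eps, eps = expR (- expR (loglog eps)) &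
    T <= loglog eps].
  by near: eps; exact: near_loglog.
rewrite !ge_max => /andP[/andP[t1 tdel] te].
have uDe : forall kappa, Sigma kappa ->
    ((detection_const del B C * loglog eps)%:E <= u_eps F eps kappa (r eps kappa))%E.
  by near: eps.
have L1 : 1 <= (L eps)%:~R :> R by near: eps; move/cvgryPge : Loo; exact.
have Lt : (L eps)%:~R / loglog eps <= 1.
  near: eps; move/cvgrPdist_le : Lt0 => /(_ 1 ltr01).
  apply: filterS => x; rewrite sub0r normrN => h.
  exact: le_trans (ler_norm _) h.
rewrite ler_pdivrMr ?mul1r in Lt; last by lra.
have /andP[ge0 _] := type2_error_01 xi eps (Theta_adaptive F Sigma (r eps))
  (threshold_test_is_test C (L eps) eps).
rewrite sub0r normrN ger0_norm//.
apply: type2_error_le => [|eta [kappa kS T2]]; first exact: ltW.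
have st0 : 0 < Num.sqrt (loglog eps) by rewrite sqrtr_gt0; lra.
apply: (@le_trans _ _ (2 / Num.sqrt (loglog eps))).
  apply: (type2_le iid_xi del0 (adm kS) C2 eps0 epsE t1 tdel _ _ T2 (uDe _ kS)).
    by rewrite L1.
  by have [+ _] := rad _ kS; exact.
rewrite ler_pdivrMr// mulrC -ler_pdivrMr//.
by rewrite -[leLHS]ger0_norm ?divr_ge0 ?(ltW e0)// -sqrtr_sqr ler_wsqrtr.
Unshelve. all: by end_near. Qed.

Lemma minimax_cvg1 (r : R -> R * R * R -> R) : phi_contains_interval Sigma ->
  radii Sigma r ->
  (limsup_sup_ratio F Sigma r (@loglog R) <= (peak_const del B ^+ 2 / 16)%:E)%E ->
  minimax_error xi eps (Theta_adaptive F Sigma (r eps))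
    @[eps --> 0^'+] --> (1 : R).
Proof.
move=> [p1 [p2 [p10 p12 phiS]]] rad lim.
have cc : 0 < peak_const del B ^+ 2 by rewrite exprn_gt0// peak_const_gt0.
have cc' : peak_const del B ^+ 2 / 16 < peak_const del B ^+ 2 / 8 by lra.
have uS := limsup_sup_ratio_near cc' lim.
apply/cvgrPdist_le => e e0.
have p0 : 0 < p2 - p1 by rewrite subr_gt0.
pose T := Num.max (Num.max 2 (2 / (p2 - p1))) (4 / ((p2 - p1) * e ^+ 2)).
near=> eps.
have [eps0 epsE] : [/\ 0 < eps, eps = expR (- expR (loglog eps)) &
    T <= loglog eps].
  by near: eps; exact: near_loglog.
rewrite !ge_max => /andP[/andP[t2 tp] te].
have uSe : forall kappa, Sigma kappa -> (u_eps F eps kappa (r eps kappa) <=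
    (peak_const del B ^+ 2 / 8 * loglog eps)%:E)%E.
  by near: eps.
rewrite ger0_norm ?subr_ge0 ?minimax_error_le1// lerBlDl -lerBlDr.
apply: (minimax_ge iid_xi del0 adm _ p10 p12 phiS eps0 epsE e0 t2 _ _ uSe).
- by move=> kappa kS; have [+ _] := rad _ kS; exact.
- by move: tp; rewrite ler_pdivrMr// mulrC.
- by move: te; rewrite ler_pdivrMr ?mulr_gt0 ?exprn_gt0// mulrC mulrAC.
Unshelve. all: by end_near. Qed.

(** The rate solves r^(s/a) = eps sqrt(t), so both two-sided bounds on [u_eps] become constant
    multiples of t. *)
Lemma exp_rate_bounds : \forall eps \near 0^'+, forall kappa, Sigma kappa ->
  ((peak_const del B ^+ 2 / 2 * loglog eps)%:E <=
     u_eps F eps kappa (exp_rate eps kappa))%E /\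
  (u_eps F eps kappa (exp_rate eps kappa) <=
     (expR (2 * B) ^+ 2 * loglog eps)%:E)%E.
Proof.
pose T := Num.max 1 (4 * B).
near=> eps => kappa kS.
have [eps0 epsE] : [/\ 0 < eps, eps = expR (- expR (loglog eps)) &
    T <= loglog eps].
  by near: eps; exact: near_loglog.
rewrite ge_max => /andP[t1 tB].
set t := loglog eps in epsE t1 tB *.
have t0 : 0 < t by lra.
set a := alpha_of kappa; set s := a + beta_of kappa.
have [/andP[da aB] /andP[db bB] q02] := adm kS.
have d0 := del0.
have a0 : 0 < a by exact: lt_le_trans da.
have s0 : 0 < s by rewrite /s; lra.
have sB : s <= 2 * B by rewrite /s -/a; lra.
pose x := eps * Num.sqrt t.
have x0 : 0 < x by rewrite mulr_gt0// sqrtr_gt0.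
have st1 : 1 <= Num.sqrt t by rewrite -[leLHS]sqrtr1 ler_wsqrtr.
have rE : exp_rate eps kappa = x `^ (a / s) by [].
have r0 : 0 < exp_rate eps kappa by rewrite rE powR_gt0.
have rK : exp_rate eps kappa `^ (s / a) = x.
  rewrite rE -powRrM (_ : a / s * (s / a) = 1) ?powRr1 ?(ltW x0)//.
  by field; rewrite !gt_eqF.
(* Needed for r <= exp(-a), the domain of [u_eps_upper]. It holds uniformly in kappa because s <= 2B
   while [T] makes t at least 4B. *)
have lnx : ln x <= - s.
  rewrite /x lnM ?posrE ?(lt_le_trans ltr01 st1)//.
  rewrite {1}epsE expRK.
  have := @le_ln1Dx R (Num.sqrt t - 1); rewrite subrKC => H.
  have h1 : ln (Num.sqrt t) <= Num.sqrt t - 1 by apply: H; lra.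
  have h2 : Num.sqrt t <= t.
    by rewrite -[leRHS](sqr_sqrtr (ltW t0)) expr2 ler_peMl//; lra.
  have h3 : 1 + t / 2 <= expR (t / 2) by exact: expR_ge1Dx.
  have -> : expR t = expR (t / 2) * expR (t / 2) by rewrite -expRD; congr expR; field.
  nra.
have ra : exp_rate eps kappa <= expR (- a).
  rewrite rE /powR gt_eqF// ler_expR mulrAC ler_pdivrMr// mulNr -mulrN.
  by rewrite ler_wpM2l// ltW.
have x2 : x ^+ 2 = eps ^+ 2 * t by rewrite exprMn sqr_sqrtr// ltW.
split.
  apply: le_trans (u_eps_lower del0 (adm kS) eps0 r0); rewrite -/a -/s rK.
  rewrite lee_fin exprMn x2 le_eqVlt; apply/orP; left; apply/eqP.
  by field; rewrite gt_eqF.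
have ra' : 0 < exp_rate eps kappa <= expR (- alpha_of kappa) by rewrite r0.
apply: le_trans (u_eps_upper del0 (adm kS) eps0 ra') _; rewrite -/a -/s rK.
rewrite lee_fin exprMn x2 le_eqVlt; apply/orP; left; apply/eqP.
by field; rewrite gt_eqF.
Unshelve. all: by end_near. Qed.

End convergence.

Theorem theorem5p2 (R : realType) (d : measure_display)
    (Omega : measurableType d) (P : probability Omega R)
    (xi : nat -> {RV P >-> R}) (iid_xi : iid_standard_normal xi)
    (Sigma : set (R * R * R)) (compact_Sigma : compact Sigma)
    (Sigma_sub : forall kappa, Sigma kappa ->
       [/\ 0 < alpha_of kappa, 0 < beta_of kappa & 0 < q_of kappa <= 2]) :
  [/\ (* (a) *)
      phi_contains_interval Sigma ->
      exists2 dlow : R, 0 < dlow &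
        forall r : R -> R * R * R -> R, radii Sigma r ->
          (limsup_sup_ratio (exp_ellipsoids R) Sigma r (@loglog R)
             <= dlow%:E)%E ->
          minimax_error xi eps
            (Theta_adaptive (exp_ellipsoids R) Sigma (r eps))
            @[eps --> 0^'+] --> (1 : R),
      (* (b) *)
      forall C : R, 2 < C ->
        (forall L : R -> int, admissible_L L ->
           type1_error xi eps (threshold_test C (L eps) eps)
             @[eps --> 0^'+] --> (0 : R)) /\
        exists2 D : R, 0 < D &
          forall L : R -> int, admissible_L L ->
          forall r : R -> R * R * R -> R, radii Sigma r ->
            (D%:E <
             liminf_inf_ratio (exp_ellipsoids R) Sigma r (@loglog R))%E ->
            type2_error xi eps
              (Theta_adaptive (exp_ellipsoids R) Sigma (r eps))
              (threshold_test C (L eps) eps)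
              @[eps --> 0^'+] --> (0 : R) &
      (* (c) *)
      phi_contains_interval Sigma ->
      adaptive_separation_rates xi (exp_ellipsoids R) Sigma
        (@loglog R) (@exp_rate R)].
Proof.
have [del [B [del0 delB adm]]] := compact_bounded_params compact_Sigma Sigma_sub.
have cc : 0 < peak_const del B ^+ 2 by rewrite exprn_gt0// peak_const_gt0.
split => [phiS|C C2|phiS].
- exists (peak_const del B ^+ 2 / 16); first by rewrite divr_gt0.
  by move=> r rad lim; apply: (minimax_cvg1 iid_xi del0 adm).
- split => [L aL|]; first exact: type1_cvg.
  exists (detection_const del B C); first exact: detection_const_gt0.
  by move=> L aL r rad lim; apply: (type2_cvg iid_xi del0 adm).
- split; last first.
    exists (peak_const del B ^+ 2 / 2), (expR (2 * B) ^+ 2); split.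
    + by rewrite divr_gt0.
    + by rewrite exprn_gt0// expR_gt0.
    + exact: exp_rate_bounds.
  split; first exact: loglog_cvg.
  pose lo := peak_const del B ^+ 2 / 16.
  (* The value 3 is an arbitrary choice of C > 2; the maximum secures the required order of the two
     constants. *)
  exists lo, (Num.max lo (detection_const del B 3)); split.
  + by rewrite divr_gt0.
  + by rewrite le_max lexx.
  move=> r rad; split => lim.
    by apply: (minimax_cvg1 iid_xi del0 adm) => //; exact: ltW.
  have {}lim : ((detection_const del B 3)%:E <
      liminf_inf_ratio (exp_ellipsoids R) Sigma r (@loglog R))%E.
    by apply: le_lt_trans lim; rewrite lee_fin le_max lexx orbT.
  have [L aL] := ex_admissible_L R.
  have C3 : 2 < 3 :> R by lra.
  have ub : type1_error xi eps (threshold_test 3 (L eps) eps) +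
      type2_error xi eps (Theta_adaptive (exp_ellipsoids R) Sigma (r eps))
        (threshold_test 3 (L eps) eps) @[eps --> 0^'+] --> (0 : R).
    rewrite -[X in _ --> X]addr0; apply: cvgD; first exact: type1_cvg.
    exact: (type2_cvg iid_xi del0 adm).
  apply: squeeze_cvgr (cvg_cst 0) ub; apply: nearW => eps.
  apply/andP; split.
    apply: minimax_error_ge => psi tpsi; rewrite addr_ge0//.
      by have /andP[] := mean_test_01 xi eps (fun=> 0) tpsi.
    by have /andP[] := type2_error_01 xi eps
      (Theta_adaptive (exp_ellipsoids R) Sigma (r eps)) tpsi.
  by apply: minimax_error_le; exact: threshold_test_is_test.
Qed.
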